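(* Let $n \in \mathbb{N}$ and let $a \in \mathbb{Z}$ satisfy $a \geq -n$. The closed convex cone $Q_{n,a}$ is the intersection of the closed half-spaces defined by the inequalities $(n+j+1)\,h(j) \geq (j+1)\,h(j+1)$ for $j \in \mathbb{N}$ and the limiting inequality which asserts that the leading coefficient of the associated Hilbert polynomial is positive. If $\hat{a} := a + \max(1,-a)$, then the extreme rays of $Q_{n,a}$ are generated by the Hilbert functions of the cyclic modules $S/\langle x_0, x_1, \dotsc, x_n\rangle^i$ for $1 \leq i \leq a+1$ and the inverse images under $T$ of the power series $$\sum_{j \geq \hat{a}} \Bigl( p_\lambda(j-\hat{a}) \prod_{\ell=1}^{\hat{a}-a-1} (j+\ell) \Bigr) t^j, \qquad \sum_{j \geq \hat{a}} \Bigl( p_\mu(j-\hat{a}-1) \prod_{\ell=0}^{\hat{a}-a-1} (j+\ell) \Bigr) t^j,$$ where $\lambda$ ranges over all integer partitions with at most $\lfloor (n-\hat{a}+a)/2 \rfloor$ parts and $\mu$ ranges over all integer partitions with at most $\lfloor (n-\hat{a}+a-1)/2 \rfloor$ parts.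
   Context: $\mathbb{N}$ is the set of non-negative integers, $\Bbbk$ is an arbitrary field, and $S := \Bbbk[x_0, x_1, \dotsc, x_n]$ has the standard $\mathbb{N}$-grading with $\deg(x_i)=1$. For a finitely generated $\mathbb{N}$-graded $S$-module $M$, the Hilbert function is $h_M(j) := \dim_{\Bbbk} M_j$ for $j \in \mathbb{N}$. $V_{n,a} \subset \mathbb{Q}^{\mathbb{N}}$ is the finite-dimensional $\mathbb{Q}$-subspace of all sequences $h \colon \mathbb{N} \to \mathbb{Q}$ such that $\sum_{j \in \mathbb{N}} h(j) t^j = (b_0 + b_1 t + \dotsb + b_{a+n} t^{a+n})/(1-t)^n$ for some $b_0, \dotsc, b_{a+n} \in \mathbb{Q}$; a sequence is identified with its generating function. For $h \in V_{n,a}$, the Hilbert polynomial of $h$ is the polynomial $q_h \in \mathbb{Q}[s]$ with $q_h(j) = h(j)$ for all $j \in \mathbb{N}$ with $j > a$. $Q_{n,a}$ denotes the closed convex hull in $V_{n,a}$ of the Hilbert functions (lying in $V_{n,a}$) of finitely generated $\mathbb{N}$-graded $S$-modules that are generated in degree zero and have no free summands (i.e. $\dim(M) < n+1$). The half-spaces in the claim are half-spaces of $V_{n,a}$. $T \colon \mathbb{Q}^{\mathbb{N}} \to \mathbb{Q}^{\mathbb{N}}$ is the linear operator $\bigl(T[h]\bigr)(j) := (n+j+1) h(j) - (j+1) h(j+1)$; on generating functions, $T\bigl[\sum_j h(j) t^j\bigr] = \sum_j \bigl(T[h](j)\bigr) t^j$. It restricts to an invertible operator on $V_{n,a}$, and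 inverse images under $T$ are taken in $V_{n,a}$. For an integer partition $\lambda = (\lambda_1, \dotsc, \lambda_r)$ with $\lambda_1 \geq \lambda_2 \geq \dotsb \geq \lambda_r \geq 0$ (parts equal to zero are allowed and counted, so $\lambda$ has $r$ parts; $r=0$ is the empty partition), define $$p_\lambda(s) := \prod_{i=1}^r (s - \lambda_{r-i+1} - 2i + 2)(s - \lambda_{r-i+1} - 2i + 1) \in \mathbb{Z}[s],$$ so $p_\varnothing = 1$. Empty products equal $1$.
   Formalization: In the second family of power series the factors (j+ℓ) are replaced by (j-â+ℓ), a change only for a ≥ 0; as printed it fails for n=2, a=0, μ=∅, where Σ j t^j = Σ (j-1) t^j + Σ t^j (j ≥ 1) is not extreme. ''Positive'' leading coefficient means coefficient of s^(n-1) is ≥ 0. *)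

(* Defs.v *)
From HB Require Import structures.
From mathcomp Require Import all_boot all_order all_algebra.
From mathcomp Require Import ring_quotient.
(* The notations of mpoly clash with those of the analysis files. *)
From mathcomp Require mpoly.
Import -(notations) mpoly.
From mathcomp Require Import boolp classical_sets functions topology normedtype.
From mathcomp Require Import convex.

Set Implicit Arguments.
Unset Strict Implicit.
Unset Printing Implicit Defensive.

Import Order.TTheory GRing.Theory Num.Theory.
Import numFieldNormedType.Exports.

Local Open Scope classical_set_scope.
Local Open Scope ring_scope.

(** * Graded modules over k[x_0, ..., x_n] *)

Notation polyring k n := (mpoly n.+1 k).

Definition var (k : fieldType) (n : nat) (i : 'I_n.+1) : polyring k n :=
  mpolyX k (mnm1 i).

Definition scal (k : fieldType) (n : nat) (c : k) : polyring k n :=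
  mpolyC n.+1 c.

Definition homogeneous (k : fieldType) (n d : nat) : set (polyring k n) :=
  [set f | f \is ishomog1 d (@mdeg n.+1)].

Record gradedModule (k : fieldType) (n : nat) := GradedModule {
  carrier :> lmodType (polyring k n);
  piece : nat -> set carrier;
  piece0 : forall j, piece j 0;
  pieceD : forall j u v, piece j u -> piece j v -> piece j (u + v);
  piece_exhaust : forall m, exists N (u : nat -> carrier),
    (forall j, piece j (u j)) /\ m = \sum_(j < N) u j;
  piece_direct : forall N (u : nat -> carrier),
    (forall j, piece j (u j)) -> \sum_(j < N) u j = 0 ->
    forall j, (j < N)%N -> u j = 0;
  piece_scale : forall d j (f : polyring k n) m,
    homogeneous d f -> piece j m -> piece (d + j) (f *: m)
}.

Section GradedModules.
Variables (k : fieldType) (n : nat).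
Local Notation S := (polyring k n).

Definition finitely_generated (M : gradedModule k n) :=
  exists r (g : 'I_r -> M), forall m : M,
    exists c : 'I_r -> S, m = \sum_(i < r) c i *: g i.

Definition generated_in_degree_zero (M : gradedModule k n) :=
  forall m : M, exists r (c : 'I_r -> S) (g : 'I_r -> M),
    (forall i, piece 0 (g i)) /\ m = \sum_(i < r) c i *: g i.

Definition annihilator (M : gradedModule k n) : set S :=
  [set f | forall m : M, f *: m = 0].

(* Krull dimension of S / Ann M: no chain of d + 1 prime ideals of S
   containing Ann M.  The zero module satisfies this for every d. *)
Definition dim_lt (M : gradedModule k n) (d : nat) :=
  ~ exists P : 'I_d.+1 -> {pred S},
      (forall i, [/\ idealr_closed (P i), prime_idealr_closed (P i) &
                     forall f, annihilator M f -> f \in P i]) /\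
      (forall i j : 'I_d.+1, (i < j)%N ->
         {subset P i <= P j} /\ ~ {subset P j <= P i}).

Definition kdim (M : gradedModule k n) (W : set M) (d : nat) :=
  exists b : 'I_d -> M,
    [/\ forall i, W (b i),
        forall m, W m ->
          exists c : 'I_d -> k, m = \sum_(i < d) scal n (c i) *: b i &
        forall c : 'I_d -> k,
          \sum_(i < d) scal n (c i) *: b i = 0 -> forall i, c i = 0].

Definition hilbert_function (M : gradedModule k n) (h : nat -> rat) :=
  forall j, exists2 d, kdim (piece (g := M) j) d & h j = d%:R.

Definition ideal_span (X : set S) : set S :=
  [set f | exists r (c g : 'I_r -> S),
     (forall l, X (g l)) /\ f = \sum_(l < r) c l * g l].

Definition irrelevant : set S := ideal_span (range (@var k n)).

Definition ideal_exp (I : set S) (i : nat) : set S :=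
  ideal_span [set f | exists g : 'I_i -> S,
    (forall l, I (g l)) /\ f = \prod_(l < i) g l].

(* M is, up to graded isomorphism, the cyclic module S / I. *)
Definition is_cyclic_quotient (I : set S) (M : gradedModule k n) :=
  exists phi : {linear S^o -> M},
    [/\ forall m, exists f, phi f = m,
        forall d f, homogeneous d f -> piece d (phi f) &
        forall f, phi f = 0 <-> I f].

End GradedModules.

(** * The space V_{n,a} and the cone Q_{n,a} *)

(* Sequences of rationals, with the topology of pointwise convergence.  It
   induces on each finite-dimensional subspace its usual topology, and such a
   subspace (in particular Vspace n a) is closed. *)
Definition sequence := {ptws nat -> rat^o}.

(* (1 - t)^n * h = b as formal power series in t. *)
Definition Vspace (n : nat) (a : int) : set sequence :=
  [set h | exists2 b : {poly rat}, (size b)%:Z <= a + n%:Z + 1 &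
     forall j, \sum_(i < j.+1) ((1 - 'X) ^+ n : {poly rat})`_i * h (j - i)%N
               = b`_j].

Definition hilbert_polynomial (a : int) (h : sequence) (q : {poly rat}) :=
  forall j : nat, a < j%:Z -> q.[j%:R] = h j.

Definition module_hilbert_functions (k : fieldType) (n : nat) (a : int) :
    set sequence :=
  [set h | Vspace n a h /\ exists M : gradedModule k n,
     [/\ finitely_generated M, generated_in_degree_zero M, dim_lt M n.+1 &
         hilbert_function M h]].

Definition Qcone (k : fieldType) (n : nat) (a : int) : set sequence :=
  smallest [set A : set sequence |
    [/\ A `<=` Vspace n a, closed A & convex_set A]]
  (module_hilbert_functions k n a).

Definition halfspace (n : nat) (a : int) (j : nat) : set sequence :=
  [set h | Vspace n a h /\ (j%:R + 1) * h j.+1 <= (n%:R + j%:R + 1) * h j].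

(* The Hilbert polynomial of an element of Vspace n a has degree at most
   n - 1; the leading coefficient is read as the coefficient of s^(n-1), which
   is a linear functional of h (possibly zero at h).  For n = 0 the Hilbert
   polynomial is 0 and there is no condition. *)
Definition limiting_halfspace (n : nat) (a : int) : set sequence :=
  [set h | Vspace n a h /\
     exists2 q, hilbert_polynomial a h q & 0 <= q`_n.-1].

(** * Extreme rays *)

Definition ray (g : sequence) : set sequence :=
  [set h | exists2 c : rat, 0 <= c & h = c *: g].

Definition extreme_ray (C R : set sequence) :=
  [/\ exists g, [/\ C g, g != 0 & R = ray g] &
      forall u v, C u -> C v -> R (u + v) -> R u /\ R v].

Definition Top (n : nat) (h : sequence) : sequence :=
  fun j => (n%:R + j%:R + 1) * h j - (j%:R + 1) * h j.+1.

Definition is_partition (la : seq nat) := sorted geq la.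

(* The parts are numbered from 1 in the product and from 0 in [nth]. *)
Definition p_ (la : seq nat) : {poly int} :=
  let r := size la in
  \prod_(1 <= i < r.+1)
    (('X - ((nth 0%N la (r - i))%:Z + 2 * i%:Z - 2)%:P) *
     ('X - ((nth 0%N la (r - i))%:Z + 2 * i%:Z - 1)%:P)).

Definition ahat (a : int) : int := a + Num.max 1 (- a).

Definition even_series (a : int) (la : seq nat) : sequence := fun j =>
  if ahat a <= j%:Z then
    ((p_ la).[j%:Z - ahat a]
       * \prod_(1 <= l < `|ahat a - a|%N) (j%:Z + l%:Z))%:~R
  else 0.

(* The linear factors are j - ahat + l, so that the series vanishes at
   j = ahat.  When a < 0, ahat = 0 and they are j + l; when a >= 0 the product
   is the single factor j - ahat, and with j in its place the series would not
   span an extreme ray (it is the sum of (j - ahat) * p_mu(j - ahat - 1) and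
   ahat * p_mu(j - ahat - 1), both nonnegative for j >= ahat). *)
Definition odd_series (a : int) (mu : seq nat) : sequence := fun j =>
  if ahat a <= j%:Z then
    ((p_ mu).[j%:Z - ahat a - 1]
       * \prod_(0 <= l < `|ahat a - a|%N) (j%:Z - ahat a + l%:Z))%:~R
  else 0.

Definition T_preimage (n : nat) (a : int) (g : sequence) : set sequence :=
  [set h | Vspace n a h /\ Top n h = g].

(* [%/] is the floor division of integers; a negative bound on the number of
   parts leaves no partition. *)
Definition ray_generators (k : fieldType) (n : nat) (a : int) : set sequence :=
  [set h | exists i : nat, [/\ (1 <= i)%N, i%:Z <= a + 1 &
     exists2 M : gradedModule k n,
       is_cyclic_quotient (ideal_exp (@irrelevant k n) i) M &
       hilbert_function M h]]
  `|` [set h | exists la, [/\ is_partition la,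
         (size la)%:Z <= ((n%:Z - ahat a + a) %/ 2)%Z &
         T_preimage n a (even_series a la) h]]
  `|` [set h | exists mu, [/\ is_partition mu,
         (size mu)%:Z <= ((n%:Z - ahat a + a - 1) %/ 2)%Z &
         T_preimage n a (odd_series a mu) h]].

(* Main.v *)
Require Import Defs.
From HB Require Import structures.
From mathcomp Require Import all_boot all_order all_algebra.
From mathcomp Require Import ring_quotient.
From mathcomp Require Import boolp classical_sets functions topology normedtype.
From mathcomp Require Import convex.
From mathcomp Require mpoly.
From mathcomp Require Import ring lra zify.
From mathcomp Require Import realalg.
Import -(notations) mpoly.
Set Implicit Arguments.
Unset Strict Implicit.
Unset Printing Implicit Defensive.
Import Order.TTheory GRing.Theory Num.Theory.
Import numFieldNormedType.Exports.
Local Open Scope classical_set_scope.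
Local Open Scope ring_scope.

(** T is diagonal on the polynomials R_d(s) = (s+1)...(s+d), with T R_d = (n-d) R_d, and a sequence
    lies in V_{n,a} exactly when, extended by 0 to the negative integers, it agrees with a
    polynomial of degree < n at all integers j > a; hence T is bijective on V_{n,a}.

    T h >= 0 for Hilbert functions: if M is generated by b_1, ..., b_r in degree 0, the products
    x^m b_i that are not combinations of smaller ones form a basis of M, closed under division,
    and counting the edges m -> m x_v with weight m_v + 1 gives (j+1) h(j+1) <= (n+j+1) h(j).
    Conversely, if T h >= 0 then for N large h is a nonnegative rational combination of the Hilbert
    functions of S/(x_0,...,x_n)^i, i <= N, and S/(x_0,...,x_(c-1))^(N+1), c <= n: these have
    T-images multiples of t^(i-1) and of sum_{j>=N} (j-N+1)...(j-N+n-c) t^j, and a polynomial with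
    positive leading coefficient is a nonnegative combination of the latter because its differences
    at N - 1 are positive.  So a multiple of h is the Hilbert function of one direct sum of such
    quotients.

    Extreme rays are thus those of the cone of nonnegative sequences in V_{n,a}, and one is left
    with polynomials that are nonnegative on the integers >= A.  Each dominates a multiple of a
    product of pairs (s-m)(s-m-1), possibly times (s-A), with at least the same integer zeros and
    no larger degree, since a run of integer zeros not starting at A carries an even number of real
    roots.  Those products have distinct roots, which forces any decomposition to be trivial. *)

(** * Bases of monic polynomials and rising factorials *)

Section MonicBasis.
Variables (R : nzRingType) (B : nat -> {poly R}).
Hypotheses (monicB : forall d, B d \is monic) (sizeB : forall d, size (B d) = d.+1).

Lemma monic_basis_size n (c : nat -> R) :
  (size (\sum_(d < n) c d *: B d)%R <= n)%N.
Proof.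
apply: (leq_trans (size_sum _ _ _)); apply/bigmax_leqP => d _.
by apply: (leq_trans (size_scale_leq _ _)); rewrite sizeB.
Qed.

Lemma monic_basis_lead n (c : nat -> R) : (\sum_(d < n.+1) c d *: B d)`_n = c n.
Proof.
rewrite big_ord_recr /= coefD coefZ nth_default ?monic_basis_size // add0r.
by have := monicB n; rewrite monicE /lead_coef sizeB => /eqP ->; rewrite mulr1.
Qed.

Lemma monic_basis n (q : {poly R}) : (size q <= n)%N ->
  exists c : nat -> R, q = \sum_(d < n) c d *: B d.
Proof.
elim: n q => [|n IH] q hq.
  by exists (fun=> 0); rewrite big_ord0; apply/eqP; rewrite -size_poly_eq0 -leqn0.
have [|c hc] := IH (q - q`_n *: B n).
  apply/leq_sizeP => j; rewrite leq_eqVlt => /orP[/eqP <-|hj].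
    have := monicB n; rewrite monicE /lead_coef sizeB => /eqP e.
    by rewrite coefB coefZ e mulr1 subrr.
  rewrite coefB coefZ nth_default ?(leq_trans hq) // [(B n)`_j]nth_default ?sizeB //.
  by rewrite mulr0 subrr.
exists (fun d => if d == n then q`_n else c d).
rewrite big_ord_recr /= eqxx -[LHS](subrK (q`_n *: B n)) hc; congr (_ + _).
by apply: eq_bigr => d _; rewrite ltn_eqF.
Qed.

End MonicBasis.

(** Its value at s is (s - c + 1)...(s - c + d): the roots c - 1, ..., c - d are the integers just
    below c. *)
Definition rising (c : rat) (d : nat) : {poly rat} :=
  \prod_(l <- iota 0 d) ('X - (c - l.+1%:R)%:P).

Lemma rising_monic c d : rising c d \is monic.
Proof. exact: monic_prod_XsubC. Qed.

Lemma size_rising c d : size (rising c d) = d.+1.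
Proof. by rewrite size_prod_XsubC size_iota. Qed.

Lemma rising0 c : rising c 0 = 1.
Proof. by rewrite /rising big_nil. Qed.

Lemma risingSr c d s : (rising c d.+1).[s] = (rising c d).[s] * (s - c + d.+1%:R).
Proof.
rewrite /rising -addn1 iotaD big_cat /= big_seq1 add0n addn1.
by rewrite hornerM hornerXsubC opprB addrA addrAC.
Qed.

(** Moving the argument down by one slides the window of factors: the top factor is lost and s - c
    enters at the bottom. This gives the difference rule [rising_diff]. *)
Lemma rising_shift c d s : (rising c d.+1).[s - 1] = (s - c) * (rising c d).[s].
Proof.
elim: d s => [|d IH] s.
  by rewrite risingSr !rising0 !hornerC; ring.
by rewrite risingSr IH risingSr -[d.+2%:R]/(1 + d.+1%:R); ring.
Qed.

Lemma rising_diff c d s :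
  (rising c d.+1).[s] - (rising c d.+1).[s - 1] = d.+1%:R * (rising c d).[s].
Proof. by rewrite rising_shift risingSr; ring. Qed.

Lemma rising_pos c d s : c < s + 1 -> 0 < (rising c d).[s].
Proof.
move=> h; elim: d => [|d IH]; first by rewrite rising0 hornerC.
rewrite risingSr mulr_gt0 //.
have : 1 <= d.+1%:R :> rat by rewrite ler1n.
by move=> h1; lra.
Qed.

Lemma rising_basis c n (q : {poly rat}) : (size q <= n)%N ->
  exists b : nat -> rat, q = \sum_(d < n) b d *: rising c d.
Proof. exact: monic_basis (rising_monic c) (size_rising c) _ _. Qed.

Lemma size_rising_sum c n (b : nat -> rat) :
  (size (\sum_(d < n) b d *: rising c d)%R <= n)%N.
Proof. exact: monic_basis_size (size_rising c) _ _. Qed.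

Lemma horner_rising_sum c n (b : nat -> rat) s :
  (\sum_(d < n) b d *: rising c d).[s] = \sum_(d < n) b d * (rising c d).[s].
Proof. by rewrite horner_sum; apply: eq_bigr => d _; rewrite hornerZ. Qed.

(** * Signs of a polynomial at large integers *)

Section EventualSign.
Variable R : archiRealFieldType.
Implicit Types p q : {poly R}.

Lemma poly_eventually_pos q : 0 < lead_coef q ->
  exists N : nat, forall j, (N <= j)%N -> 0 < q.[j%:R].
Proof.
(* A uniform lower bound e > 0 is what survives the Horner step from q to q * X + c. *)
move=> hq; suff [N [e e0 h]] : exists N : nat, exists2 e : R, 0 < e &
    forall j, (N <= j)%N -> e <= q.[j%:R].
  by exists N => j hj; apply: lt_le_trans (h j hj).
elim/poly_ind: q hq => [|q c IH]; first by rewrite lead_coef0 ltxx.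
have [->|q0] := eqVneq q 0.
  rewrite mul0r add0r lead_coefC => c0.
  by exists 0%N; exists c => // j _; rewrite hornerC.
have -> : lead_coef (q * 'X + c%:P) = lead_coef q.
  rewrite lead_coefDl ?lead_coefMX // size_polyC size_mulX //.
  by case: eqP => //= _; rewrite ltnS size_poly_gt0.
move=> /IH [N [e e0 h]].
(* Beyond this bound e * j >= 1 - c, so the new polynomial is at least 1. *)
exists (maxn N (Num.bound `|(1 - c) / e|)); exists 1 => // j.
rewrite geq_max => /andP[hN hb]; rewrite hornerMXaddC.
have h1 : (1 - c) / e <= j%:R.
  apply: (le_trans (ler_norm _)); apply/ltW/(lt_le_trans (archi_boundP (normr_ge0 _))).
  by rewrite ler_nat.
have h2 : 1 - c <= e * j%:R by rewrite mulrC -ler_pdivrMr.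
have h3 : e * j%:R <= q.[j%:R] * j%:R by rewrite ler_wpM2r // h.
lra.
Qed.

Lemma lead_coef_ge0 q N : (forall j, (N <= j)%N -> 0 <= q.[j%:R]) -> 0 <= lead_coef q.
Proof.
move=> h; rewrite leNgt; apply/negP => hl.
have [|M hM] := @poly_eventually_pos (- q); first by rewrite lead_coefN oppr_gt0.
have := hM _ (leq_maxl M N); rewrite hornerN oppr_gt0 => hlt.
by have := h _ (leq_maxr M N); rewrite leNgt hlt.
Qed.

Lemma poly_eventually_eq p q N :
  (forall j, (N <= j)%N -> p.[j%:R] = q.[j%:R]) -> p = q.
Proof.
move=> h; apply/eqP; rewrite -subr_eq0 -lead_coef_eq0 eq_le; apply/andP; split.
  rewrite -oppr_ge0 -lead_coefN; apply: (@lead_coef_ge0 _ N) => j hj.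
  by rewrite hornerN hornerD hornerN h // subrr oppr0.
by apply: (@lead_coef_ge0 _ N) => j hj; rewrite hornerD hornerN h // subrr.
Qed.

Lemma lead_coef_size q n : (size q <= n.+1)%N -> 0 < q`_n -> 0 < lead_coef q.
Proof.
move=> hs h0; rewrite /lead_coef; suff -> : size q = n.+1 by [].
apply/eqP; rewrite eqn_leq hs ltnNge; apply/negP => hn.
by rewrite nth_default // ltxx in h0.
Qed.

End EventualSign.

(* Backward differences in s lower the index of the rising factorials, so the coefficients are
   the iterated differences of q at N - 1, which have positive leading coefficient in N. *)
Lemma rising_expansion_ge0 n (q : {poly rat}) : (size q <= n)%N -> 0 <= lead_coef q ->
  exists N0 : nat, forall N, (N0 <= N)%N ->
    exists2 b : nat -> rat, (forall d, 0 <= b d) &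
      q = \sum_(d < n) b d *: rising N%:R d.
Proof.
elim: n q => [|n IH] q hq hl.
  exists 0%N => N _; exists (fun=> 0) => //.
  by rewrite big_ord0; apply/eqP; rewrite -size_poly_eq0 -leqn0.
have [hn|hn] := leqP (size q) n.
  have [N0 h] := IH q hn hl; exists N0 => N /h [b b0 hb].
  exists (fun d => if (d < n)%N then b d else 0) => [d|]; first by case: ifP.
  rewrite big_ord_recr /= ltnn scale0r addr0 {1}hb.
  by apply: eq_bigr => d _; rewrite ltn_ord.
have sq : size q = n.+1 by apply/eqP; rewrite eqn_leq hq hn.
have [c hc] := rising_basis 0 hq.
have cn : 0 < c n.
  rewrite -(monic_basis_lead (rising_monic 0) (size_rising 0) n c) -hc.
  have <- : lead_coef q = q`_n by rewrite /lead_coef sq.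
  by rewrite lt_neqAle eq_sym hl lead_coef_eq0 -size_poly_eq0 sq.
(* The backward difference of q; its leading coefficient is a positive multiple of that of q, so
   induction applies. *)
pose q' := \sum_(d < n) (c d.+1 * d.+1%:R) *: rising 0 d.
have q'E s : q.[s] - q.[s - 1] = q'.[s].
  rewrite hc !horner_rising_sum !big_ord_recl /= !rising0 !hornerC opprD addrACA subrr add0r.
  rewrite -sumrB (horner_rising_sum 0 n (fun d => c d.+1 * d.+1%:R)).
  by apply: eq_bigr => d _; rewrite -mulrBr rising_diff mulrA.
have [N1 hN1] : exists N0 : nat, forall N, (N0 <= N)%N ->
    exists2 b : nat -> rat, (forall d, 0 <= b d) &
      q' = \sum_(d < n) b d *: rising N%:R d.
  apply: IH; first exact: (size_rising_sum 0 n (fun d => c d.+1 * d.+1%:R)).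
  rewrite /q'; case: n cn {hq hn sq hc q' q'E} => [|n] cn; first by rewrite big_ord0 lead_coef0.
  apply/ltW/(@lead_coef_size _ _ n).
    exact: (size_rising_sum 0 n.+1 (fun d => c d.+1 * d.+1%:R)).
  rewrite (monic_basis_lead (rising_monic 0) (size_rising 0) n (fun d => c d.+1 * d.+1%:R)).
  by rewrite mulr_gt0 ?ltr0n.
have [|N2 hN2] := @poly_eventually_pos _ q.
  by rewrite lt_neqAle hl eq_sym lead_coef_eq0 -size_poly_eq0 sq.
exists (maxn N1 N2.+1) => N; rewrite geq_max => /andP[/hN1 [b b0 hb] hN].
have N0 : (0 < N)%N by apply: leq_ltn_trans hN.
(* All rising factorials of positive degree vanish at N - 1, so the constant coefficient must be q(N
   - 1); the others integrate those of q'. *)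
exists (fun d => if d is e.+1 then b e / e.+1%:R else q.[N%:R - 1]).
  case=> [|e]; last by rewrite divr_ge0.
  by rewrite -(natrB _ N0) ltW // hN2 // subn1 -ltnS prednK.
set r := \sum_(_ < _) _.
have rE s : r.[s] - r.[s - 1] = q'.[s].
  rewrite hb /r big_ord_recl /= rising0 !hornerD !hornerZ !hornerC opprD addrACA subrr add0r.
  rewrite (horner_rising_sum N%:R n b) !horner_sum -sumrB; apply: eq_bigr => d _.
  by rewrite !hornerZ -mulrBr rising_diff mulrA divfK // pnatr_eq0.
have eN : q.[N%:R - 1] = r.[N%:R - 1].
  rewrite /r big_ord_recl /= rising0 hornerD hornerZ hornerC mulr1 horner_sum.
  rewrite big1 ?addr0 // => d _.
  by rewrite hornerZ rising_shift subrr mul0r mulr0.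
(* Both sides agree at N - 1 and have the same differences, hence agree at every later integer. *)
apply: (@poly_eventually_eq _ _ _ N.-1) => j /subnKC <-.
elim: (j - N.-1)%N => [|i IHi]; first by rewrite addn0 -subn1 natrB.
have e : (N.-1 + i)%:R = (N.-1 + i.+1)%:R - 1 :> rat by rewrite addnS -natr1 addrK.
have := q'E (N.-1 + i.+1)%:R; rewrite -(rE (N.-1 + i.+1)%:R) -!e IHi => /addIr.
by [].
Qed.

(** * The space V_{n,a} and the operator T *)

(** Extension by zero to all integers. For a < 0 this encodes the zeros that V_{n,a} imposes on the
    tail polynomial at the negative integers above a. *)
Definition ext0 (h : nat -> rat) (j : int) : rat := if j is Posz i then h i else 0.

(** Multiplication by 1 - t on generating functions. *)
Definition bdiff (f : int -> rat) (j : int) : rat := f j - f (j - 1).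

Definition tail_poly (n : nat) (a : int) (f : int -> rat) (q : {poly rat}) :=
  (size q <= n)%N /\ forall j : int, a < j -> q.[j%:~R] = f j.

Lemma int_ind_above (a : int) (P : int -> Prop) :
  P (a + 1) -> (forall j : int, a + 1 < j -> P (j - 1) -> P j) -> forall j : int, a < j -> P j.
Proof.
move=> h0 hS j hj.
have -> : j = a + 1 + (absz (j - a - 1)%R)%:Z by lia.
elim: (absz (j - a - 1)%R) => [|i IH]; first by rewrite addr0.
apply: hS; first by lia.
by have -> : a + 1 + i.+1%:Z - 1 = a + 1 + i%:Z by lia.
Qed.

(** Induction on n: one difference lowers the degree bound by one and raises the threshold a by one;
    conversely a polynomial difference is summed in the rising basis. *)
Lemma iter_bdiff_poly n (a : int) (f : int -> rat) :
  (forall j, a + n%:Z < j -> iter n bdiff f j = 0) <-> exists q, tail_poly n a f q.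
Proof.
elim: n a f => [|n IH] a f.
  split=> [h|[q [hq h]] j].
    exists 0; split=> [|j hj]; first by rewrite size_poly0.
    by have := h j; rewrite addr0 horner0 => /(_ hj) /= ->.
  rewrite addr0 => hj /=; rewrite -h //.
  by move: hq; rewrite leqn0 size_poly_eq0 => /eqP ->; rewrite horner0.
have -> : (forall j, a + n.+1%:Z < j -> iter n.+1 bdiff f j = 0) <->
    (forall j, (a + 1) + n%:Z < j -> iter n bdiff (bdiff f) j = 0).
  by split=> h j hj; [rewrite -iterSr | rewrite iterSr]; apply: h; lia.
rewrite IH; split=> [[q' [hq' h]]|[q [hq h]]].
  have [b hb] := rising_basis 0 hq'.
  pose q := \sum_(d < n) (b d / d.+1%:R) *: rising 0 d.+1.
  have qE s : q.[s] - q.[s - 1] = q'.[s].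
    rewrite hb horner_rising_sum !horner_sum -sumrB; apply: eq_bigr => d _.
    by rewrite !hornerZ -mulrBr rising_diff mulrA divfK // pnatr_eq0.
  (* The constant of summation is fixed by the value at a + 1, the first integer of the tail. *)
  exists (q + (f (a + 1) - q.[(a + 1)%:~R])%:P); split.
    rewrite (leq_trans (size_polyD _ _)) // geq_max (leq_trans (size_polyC_leq1 _)) // andbT.
    apply: (leq_trans (size_sum _ _ _)); apply/bigmax_leqP => d _.
    by apply: (leq_trans (size_scale_leq _ _)); rewrite size_rising ltnS.
  apply: int_ind_above => [|j hj IHj]; first by rewrite hornerD hornerC addrC subrK.
  have := qE j%:~R; rewrite h // /bdiff -IHj !hornerD !hornerC intrB => e.
  by lra.
have [b hb] := rising_basis 0 hq.
pose q' := \sum_(d < n) (b d.+1 * d.+1%:R) *: rising 0 d.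
exists q'; split=> [|j hj].
  exact: (size_rising_sum 0 n (fun d => b d.+1 * d.+1%:R)).
rewrite /bdiff -!h; [|lia|lia].
rewrite intrB (horner_rising_sum 0 n (fun d => b d.+1 * d.+1%:R)) hb.
rewrite !horner_rising_sum !big_ord_recl /= !rising0 !hornerC opprD addrACA subrr add0r.
by rewrite -sumrB; apply: eq_bigr => d _; rewrite -mulrBr rising_diff mulrA.
Qed.

Lemma tail_poly_uniq n a f q q' : tail_poly n a f q -> tail_poly n a f q' -> q = q'.
Proof.
move=> [_ h] [_ h']; apply: (@poly_eventually_eq _ _ _ `|a|.+1) => j hj.
by rewrite -[j%:R]/(j%:Z%:~R) h ?h' //; lia.
Qed.

Lemma tail_poly_ge0 n a h q : tail_poly n a (ext0 h) q -> (forall j, 0 <= h j) ->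
  0 <= lead_coef q.
Proof.
move=> [_ hq] h0; apply: (@lead_coef_ge0 _ _ `|a|.+1) => j hj.
by rewrite -[j%:R]/(j%:Z%:~R) hq; [exact: h0 | lia].
Qed.

Lemma iter_bdiff_neg h n (j : int) : j < 0 -> iter n bdiff (ext0 h) j = 0.
Proof.
elim: n j => [|n IH] j hj /=; first by case: j hj.
by rewrite /bdiff !IH ?subrr //; lia.
Qed.

Lemma iter_bdiff_coef n (h : nat -> rat) (j : nat) :
  \sum_(i < j.+1) ((1 - 'X) ^+ n : {poly rat})`_i * h (j - i)%N = iter n bdiff (ext0 h) j%:Z.
Proof.
elim: n j => [|n IH] j.
  rewrite expr0 big_ord_recl coef1 mul1r subn0 big1 ?addr0 // => i _.
  by rewrite coef1 mul0r.
rewrite exprSr mulrBr mulr1 /=.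
under eq_bigr do rewrite coefB coefMX mulrBl.
rewrite sumrB IH; congr (_ - _).
rewrite big_ord_recl /= mul0r add0r; case: j => [|j].
  by rewrite big_ord0 iter_bdiff_neg.
rewrite -[j.+1%:Z - 1]/(Posz (j.+1 - 1)%N) subn1 -IH.
by apply: eq_bigr => i _; rewrite subSS.
Qed.

Section TopOperator.
Variable n : nat.

(** The operator T on plain functions, without the topology carried by [sequence]. *)
Definition Tstep (h : nat -> rat) (j : nat) : rat :=
  (n%:R + j%:R + 1) * h j - (j%:R + 1) * h j.+1.

Definition Tpoly (b : nat -> rat) : {poly rat} :=
  \sum_(d < n) (b d * (n%:R - d%:R)) *: rising 0 d.

(* The rising factorials (s+1)...(s+d) are eigenvectors of T. *)
Lemma rising_Tstep d s :
  (n%:R + s + 1) * (rising 0 d).[s] - (s + 1) * (rising 0 d).[s + 1]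
  = (n%:R - d%:R) * (rising 0 d).[s].
Proof.
have := rising_shift 0 d (s + 1); rewrite subr0 addrK => <-.
by rewrite risingSr -(natr1 d); ring.
Qed.

Lemma Tpoly_horner b s : (Tpoly b).[s] =
  (n%:R + s + 1) * (\sum_(d < n) b d *: rising 0 d).[s]
  - (s + 1) * (\sum_(d < n) b d *: rising 0 d).[s + 1].
Proof.
rewrite (horner_rising_sum 0 n (fun d => b d * (n%:R - d%:R))) !horner_rising_sum.
rewrite !mulr_sumr -sumrB; apply: eq_bigr => d _.
by rewrite -mulrA -rising_Tstep; ring.
Qed.

Lemma Tstep_tail a h q : tail_poly n a (ext0 h) q ->
  exists q', tail_poly n a (ext0 (Tstep h)) q'.
Proof.
move=> [hq hj]; have [b hb] := rising_basis 0 hq.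
exists (Tpoly b); split=> [|j aj].
  exact: (size_rising_sum 0 n (fun d => b d * (n%:R - d%:R))).
have e : j%:~R + 1 = (j + 1)%:~R :> rat by rewrite intrD.
rewrite Tpoly_horner -hb e !hj //; last by lia.
case: j aj {e} => [j|[|j]] aj /=.
- by rewrite /Tstep addn1 intrD.
(* At j = -1 the value h 0 enters with coefficient j + 1 = 0, so T is compatible with the extension
   by zero. *)
- have -> : (-1)%Z + 1 = 0 :> int by [].
  by rewrite mulr0 mul0r subr0.
- have -> : Negz j.+1 + 1 = Negz j by lia.
  by rewrite /= !mulr0 subr0.
Qed.

(** The recursion T h = 0 makes h proportional to [rising 0 n], whose degree n is too large for a
    tail polynomial of size at most n. *)
Lemma Tstep_inj a h q : tail_poly n a (ext0 h) q ->
  (forall j, Tstep h j = 0) -> forall j, h j = 0.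
Proof.
move=> [hq hj] hT; pose r := rising 0 n.
have hr (j : nat) : h j * r.[0] = h 0%N * r.[j%:R].
  elim: j => [|j IH] //; have := hT j; rewrite /Tstep => /eqP; rewrite subr_eq0 => /eqP e.
  have j0 : j%:R + 1 != 0 :> rat by rewrite natr1 pnatr_eq0.
  apply: (mulfI j0); rewrite mulrA -e -mulrA IH.
  have := rising_Tstep n j%:R; rewrite subrr mul0r => /eqP; rewrite subr_eq0 => /eqP e2.
  by rewrite mulrCA e2 -natr1; ring.
have r0 : r.[0] != 0 by rewrite gt_eqF // rising_pos.
have h0 : h 0%N = 0.
  have e : r.[0] *: q = h 0%N *: r.
    apply: (@poly_eventually_eq _ _ _ `|a|.+1) => j aj.
    have qj : q.[j%:R] = h j by apply: (hj j%:Z); lia.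
    by rewrite !hornerZ -hr qj mulrC.
  apply/eqP/negPn/negP => h0; have := congr1 (fun p : {poly rat} => size p) e.
  by rewrite /= !size_scale // size_rising => e2; rewrite e2 ltnn in hq.
by move=> j; apply: (mulIf r0); rewrite hr h0 !mul0r.
Qed.

(** The equation for T h at j determines h j from h (j + 1), because n + j + 1 is nonzero; values
    are filled in downwards from A. *)
Lemma Tstep_fill (A : nat) (g p : nat -> rat) :
  exists h, (forall j, (A <= j)%N -> h j = p j) /\
            (forall j, (j < A)%N -> Tstep h j = g j).
Proof.
elim: A p => [|A IH] p; first by exists p.
have hA : n%:R + A%:R + 1 != 0 :> rat by rewrite -natrD natr1 pnatr_eq0.
have [h [h1 h2]] := IH (fun j => if j == A then
  (g A + (A%:R + 1) * p A.+1) / (n%:R + A%:R + 1) else p j).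
exists h; split=> [j hj|j]; first by rewrite h1 ?gtn_eqF // ltnW.
rewrite ltnS leq_eqVlt => /orP[/eqP ->|]; last exact: h2.
by rewrite /Tstep !h1 // eqxx gtn_eqF // mulrC divfK // addrK.
Qed.

(** The tail is inverted in the eigenbasis, the eigenvalues n - d with d < n being nonzero, and the
    values at j <= a are obtained by downward recursion. *)
Lemma Tstep_surj (a : int) g q : - n%:Z <= a -> tail_poly n a (ext0 g) q ->
  exists h, (exists p, tail_poly n a (ext0 h) p) /\ forall j, Tstep h j = g j.
Proof.
move=> han [hq hj]; have [b hb] := rising_basis 0 hq.
pose p := \sum_(d < n) (b d / (n%:R - d%:R)) *: rising 0 d.
have pE s : (n%:R + s + 1) * p.[s] - (s + 1) * p.[s + 1] = q.[s].
  rewrite -(Tpoly_horner (fun d => b d / (n%:R - d%:R))) hb; congr horner.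
  apply: eq_bigr => d _; rewrite divfK // subr_eq0 eqr_nat gtn_eqF //.
pose A := (if (a < 0)%R then 0 else `|a|.+1)%N.
have hA (j : nat) : (A <= j)%N = (a < j%:Z) by rewrite /A; case: ltP => ?; lia.
have [h [h1 h2]] := Tstep_fill A g (fun j => p.[j%:R]).
(* At s = -(l + 1) the relation reads (n - l) p(s) = -l p(s + 1). It starts with l = 0, and n - l is
   nonzero since -n <= a < s; hence p vanishes at the negative integers above a. *)
have pN (i : nat) : a < Negz i -> p.[(Negz i)%:~R] = 0.
  have key (l : nat) : a < Negz l -> (n%:R - l%:R) * p.[(Negz l)%:~R]
      = - l%:R * p.[(Negz l + 1)%:~R].
    move=> al; have eN : (Negz l)%:~R + 1 = - l%:R :> rat.
      by rewrite NegzE mulrNz -pmulrn -natr1 opprD subrK.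
    have := pE (Negz l)%:~R; rewrite hj // intrD -addrA eN /= => /eqP.
    by rewrite subr_eq0 => /eqP.
  have nl (l : nat) : a < Negz l -> (n%:R - l%:R : rat) != 0.
    by move=> al; rewrite subr_eq0 eqr_nat; lia.
  elim: i => [|i IH] ai; apply: (mulfI (nl _ ai)); rewrite key // mulr0.
    by rewrite oppr0 mul0r.
  have -> : Negz i.+1 + 1 = Negz i by lia.
  by rewrite IH ?mulr0 //; lia.
exists h; split=> [|j].
  exists p; split.
    exact: (size_rising_sum 0 n (fun d => b d / (n%:R - d%:R))).
  case=> [j|j] aj /=; last exact: pN.
  by rewrite h1 // hA.
have [jA|Aj] := ltnP j A; first exact: h2.
have e := pE j%:R; rewrite /Tstep !h1 //; last by rewrite leqW.
by rewrite -natr1 e (hj j%:Z) // -hA.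
Qed.

End TopOperator.

(** * Polynomials nonnegative on the integers *)

(** The least elements of disjoint pairs {m, m + 1} of integers >= w, in increasing order. *)
Fixpoint spaced (w : nat) (ms : seq nat) :=
  if ms is m :: ms' then (w <= m)%N && spaced m.+2 ms' else true.

Definition pairs (ms : seq nat) : seq nat := flatten [seq [:: m; m.+1] | m <- ms].

Lemma spacedW v w ms : (v <= w)%N -> spaced w ms -> spaced v ms.
Proof. by case: ms => //= m ms h /andP[h1 ->]; rewrite (leq_trans h h1). Qed.

Lemma size_pairs ms : size (pairs ms) = (size ms).*2.
Proof. by rewrite /pairs; elim: ms => //= m ms ->. Qed.

Lemma spaced_pairs_ge w ms : spaced w ms -> all (leq w) (pairs ms).
Proof.
elim: ms w => //= m ms IH w /andP[wm /IH/allP h].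
rewrite wm (leqW wm) /=; apply/allP => j /h hj.
by apply: leq_trans hj; rewrite !leqW.
Qed.

Lemma uniq_pairs w ms : spaced w ms -> uniq (pairs ms).
Proof.
elim: ms w => //= m ms IH w /andP[wm hm].
have /allP h := spaced_pairs_ge hm.
rewrite (IH _ hm) in_cons negb_or andbT -andbA; apply/and3P; split; first by rewrite ltn_eqF.
all: by apply/negP => /h; lia.
Qed.

Section Cover.
Variable R : rcfType.
Implicit Types g : {poly R}.

Lemma factor_root g c : root g c -> exists2 g', g = g' * ('X - c%:P) &
  g != 0 -> size g = (size g').+1.
Proof.
move=> /factor_theorem[g' ->]; exists g' => // h.
rewrite size_Mmonic ?monicXsubC ?size_XsubC ?addn2 //.
by apply: contraNneq h => ->; rewrite mul0r.
Qed.

(* A root z > x where g does not change sign forces a second real root of g / (X - z) between x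
   and z + 1; dividing by both keeps the hypotheses. *)
Lemma pairs_cover_gap g (w : nat) (x : R) : x < w%:R -> 0 < g.[x] ->
  (forall j, (w <= j)%N -> 0 <= g.[j%:R]) ->
  exists ms, [/\ spaced w ms, ((size ms).*2 < size g)%N &
    forall j, (w <= j)%N -> root g j%:R -> j \in pairs ms].
Proof.
have [N] := ubnP (size g); elim: N g w => // N IH g w; rewrite ltnS => sg xw gx g0.
have gn0 : g != 0 by apply: contraTneq gx => ->; rewrite horner0 ltxx.
have [/= ex|nex] := pselect (exists z, (w <= z)%N && root g z%:R); last first.
  exists [::]; split=> //; first by rewrite size_poly_gt0.
  by move=> j wj rj; case: nex; exists j; rewrite wj.
case: (ex_minnP ex) => z /andP[wz rz] zmin {ex}.
have xz : x < z%:R by apply: lt_le_trans xw _; rewrite ler_nat.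
have [g1 eg sg1] := factor_root rz; rewrite (sg1 gn0) {sg1} in sg *.
have g10 j : (z < j)%N -> 0 <= g1.[j%:R].
  move=> zj; have : 0 <= g.[j%:R] by rewrite g0 // (leq_trans wz) // ltnW.
  by rewrite eg hornerM hornerXsubC pmulr_lge0 // subr_gt0 ltr_nat.
have g1x : g1.[x] < 0.
  by move: gx; rewrite eg hornerM hornerXsubC nmulr_lgt0 // subr_lt0.
have xz1 : x < z.+1%:R by apply: lt_trans xz _; rewrite ltr_nat.
have [r] : exists2 r, x < r <= z.+1%:R & root g1 r.
  have [r] : exists2 r, r \in `[x, z.+1%:R] & root g1 r.
    by apply: poly_ivt; [exact: ltW | rewrite (ltW g1x) g10].
  rewrite in_itv /= => /andP[xr rz1] rr; exists r => //; rewrite rz1 andbT lt_neqAle xr andbT.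
  by apply: contraTneq rr => <-; rewrite rootE lt_eqF.
move=> /andP[xr rz1] rr.
have [g2 eg1 sg2] := factor_root rr; rewrite {}sg2 in sg *; last first.
  by apply: contraTneq g1x => ->; rewrite horner0 ltxx.
have [||||ms [h1 h2 h3]] := IH g2 z.+2 _ (lt_trans xz1 _) _ _.
- exact: leq_trans sg.
- by rewrite ltr_nat.
- by move: g1x; rewrite eg1 hornerM hornerXsubC nmulr_llt0 // subr_lt0.
- move=> j zj; have : 0 <= g1.[j%:R] by apply: g10; exact: ltn_trans zj.
  rewrite eg1 hornerM hornerXsubC pmulr_lge0 // subr_gt0; apply: le_lt_trans rz1 _.
  by rewrite ltr_nat.
exists (z :: ms); split=> [||j wj].
- by rewrite /= wz.
- by rewrite doubleS !ltnS.
rewrite eg eg1 !rootM !root_XsubC !eqr_nat /= !inE => rj.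
have [-> //|jz] := eqVneq j z; have [-> //|jz1] := eqVneq j z.+1; rewrite /= ?orbT //.
have zj : (z <= j)%N by apply: zmin; rewrite wj eg eg1 !rootM !root_XsubC !eqr_nat.
have {zj jz jz1}zj : (z.+1 < j)%N by rewrite ltn_neqAle eq_sym jz1 ltn_neqAle eq_sym jz.
apply: h3 => //; move: rj; rewrite [j == z]gtn_eqF ?(ltnW zj) //= orbF.
case/orP => // /eqP e; move: rz1; rewrite -e ler_nat leqNgt zj //.
Qed.

(** Roots at m, m + 1, ... are divided out one at a time until a nonroot is reached, where
    [pairs_cover_gap] applies. The boolean b records whether the initial run has odd length, leaving
    m unpaired. *)
Lemma pairs_cover g (m : nat) : g != 0 -> (forall j, (m <= j)%N -> 0 <= g.[j%:R]) ->
  exists (b : bool) ms, [/\ spaced (m + b) ms, ((size ms).*2 + b < size g)%N &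
    forall j, (m <= j)%N -> root g j%:R -> (b && (j == m)) || (j \in pairs ms)].
Proof.
have [N] := ubnP (size g); elim: N g m => // N IH g m; rewrite ltnS => sg gn0 g0.
have [rm|rm] := boolP (root g m%:R); last first.
  have gm : 0 < g.[m%:R] by rewrite lt_neqAle eq_sym g0 // andbT.
  have [||ms [h1 h2 h3]] := @pairs_cover_gap g m.+1 _ _ gm.
  - by rewrite ltr_nat.
  - by move=> j mj; rewrite g0 // ltnW.
  exists false, ms; rewrite !addn0; split=> //; first exact: spacedW h1.
  move=> j; rewrite leq_eqVlt => /orP[/eqP <-|]; last exact: h3.
  by rewrite (negPf rm).
have [g1 eg sg1] := factor_root rm; rewrite (sg1 gn0) {sg1} in sg *.
have [||| b [ms [h1 h2 h3]]] := IH g1 m.+1 _ _ _.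
- exact: leq_trans sg.
- by apply: contraNneq gn0 => g10; rewrite eg g10 mul0r.
- move=> j mj; have : 0 <= g.[j%:R] by rewrite g0 // ltnW.
  by rewrite eg hornerM hornerXsubC pmulr_lge0 // subr_gt0 ltr_nat.
have rj (j : nat) : (m <= j)%N -> root g j%:R -> j = m \/
    [/\ (m < j)%N & (b && (j == m.+1)) || (j \in pairs ms)].
  rewrite leq_eqVlt => /orP[/eqP ->|mj]; first by left.
  rewrite eg rootM root_XsubC eqr_nat gtn_eqF // orbF => rj.
  by right; split=> //; apply: h3.
case: b h1 h2 {h3} rj => /= h1 h2 rj.
  exists false, (m :: ms); rewrite /= !addn0; split.
  - by rewrite addn1 in h1; rewrite leqnn h1.
  - by rewrite addn1 in h2; rewrite doubleS ltnS.
  move=> j mj /(rj j mj) [->|[_ /orP[/eqP ->|h]]]; rewrite /pairs /= !inE ?eqxx ?orbT //.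
  by rewrite -/(pairs ms) h !orbT.
exists true, ms; rewrite /= addn1; rewrite !addn0 in h1 h2; split=> //.
  by rewrite addn1 ltnS.
by move=> j mj /(rj j mj) [->|[_ h]]; rewrite ?eqxx ?h ?orbT.
Qed.

End Cover.

(** The intermediate value argument takes place over the real algebraic numbers; signs and zeros at
    integers are the same there. *)
Lemma pairs_cover_rat (g : {poly rat}) (m : nat) : g != 0 ->
  (forall j, (m <= j)%N -> 0 <= g.[j%:R]) ->
  exists (b : bool) ms, [/\ spaced (m + b) ms, ((size ms).*2 + b < size g)%N &
    forall j, (m <= j)%N -> root g j%:R -> (b && (j == m)) || (j \in pairs ms)].
Proof.
move=> g0 hg; pose f : {rmorphism rat -> realalg} := ratr.
have hf j : (map_poly f g).[j%:R] = f g.[j%:R] by rewrite -(rmorph_nat f) horner_map.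
have [||b [ms [h1 h2 h3]]] := @pairs_cover realalg (map_poly f g) m.
- by rewrite map_poly_eq0.
- by move=> j mj; rewrite hf ler0q hg.
exists b, ms; split=> //; first by rewrite size_map_poly in h2.
by move=> j mj rj; apply: h3 => //; rewrite rootE hf fmorph_eq0.
Qed.

(** Leading coefficients settle all large integers; each of the finitely many others allows a small
    enough e, because r vanishes where g does. *)
Lemma poly_dominate (g r : {poly rat}) (m : nat) :
  (forall j, (m <= j)%N -> 0 <= g.[j%:R]) -> (forall j, (m <= j)%N -> 0 <= r.[j%:R]) ->
  (forall j, (m <= j)%N -> root g j%:R -> root r j%:R) -> (size r <= size g)%N -> g != 0 ->
  exists2 e : rat, 0 < e & forall j, (m <= j)%N -> e * r.[j%:R] <= g.[j%:R].
Proof.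
move=> g0 r0 hr sr gn0.
have lg : 0 < lead_coef g by rewrite lt_neqAle eq_sym lead_coef_eq0 gn0 (lead_coef_ge0 g0).
pose n := (size g).-1; have sg : size g = n.+1 by rewrite prednK // size_poly_gt0.
(* Makes the coefficient of g - e0 r in degree n positive; the + 1 keeps the denominator nonzero. *)
pose e0 := lead_coef g / (`|r`_n| + 1).
have r1 : 0 < `|r`_n| + 1 by have := normr_ge0 r`_n; lra.
have e00 : 0 < e0 by rewrite divr_gt0.
have [|M hM] := @poly_eventually_pos _ (g - e0 *: r).
  apply: (@lead_coef_size _ _ n).
    rewrite (leq_trans (size_polyD _ _)) // size_polyN geq_max sg leqnn /=.
    by rewrite (leq_trans (size_scale_leq _ _)) // -sg.
  rewrite coefB coefZ -/(lead_coef g) subr_gt0 /e0 mulrAC ltr_pdivrMr //.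
  rewrite ltr_pM2l //; have := ler_norm r`_n; lra.
suff [e he h] : exists2 e : rat, 0 < e <= e0 &
    forall j, (m <= j)%N -> (j < M)%N -> e * r.[j%:R] <= g.[j%:R].
  case/andP: he => he1 he2; exists e => // j mj; have [/h|Mj] := ltnP j M; first exact.
  have := hM j Mj; rewrite hornerD hornerN hornerZ subr_gt0 => /ltW; apply: le_trans.
  by rewrite ler_wpM2r // r0.
elim: M {hM} => [|M [e /andP[he1 he2] h]]; first by exists e0; rewrite ?e00 ?lexx.
have [mM|Mm] := leqP m M; last first.
  exists e; first by rewrite he1.
  by move=> j mj jM; apply: h => //; lia.
have [rM|gM] := boolP (root g M%:R).
  exists e; first by rewrite he1.
  move=> j mj; rewrite ltnS leq_eqVlt => /orP[/eqP ->|/h]; last exact.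
  by have := hr M mM rM; move: rM; rewrite !rootE => /eqP -> /eqP ->; rewrite mulr0.
have gM0 : 0 < g.[M%:R] by rewrite lt_neqAle eq_sym gM g0.
have rM1 : 0 < r.[M%:R] + 1 by have := r0 M mM; lra.
exists (Num.min e (g.[M%:R] / (r.[M%:R] + 1))).
  by rewrite lt_min he1 divr_gt0 //= ge_min he2.
move=> j mj; rewrite ltnS leq_eqVlt => /orP[/eqP ->|jM].
  apply: (@le_trans _ _ (g.[M%:R] / (r.[M%:R] + 1) * r.[M%:R])).
    by rewrite ler_wpM2r ?r0 // ge_min lexx orbT.
  rewrite mulrAC ler_pdivrMr // ler_wpM2l ?g0 //; lra.
by apply: le_trans (h j mj jM); rewrite ler_wpM2r ?r0 // ge_min lexx.
Qed.

(** * Standard bases and weighted counting of monomials *)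

Lemma span_mapP (k : fieldType) (V : vectType k) (I : eqType) (f : I -> V) (l : seq I) v :
  uniq l -> v \in <<[seq f y | y <- l]>>%VS <-> exists c : I -> k, v = \sum_(y <- l) c y *: f y.
Proof.
elim: l v => [|x l IH] v /=.
  move=> _; rewrite span_nil memv0; split=> [/eqP ->|[c]]; last by rewrite big_nil => ->.
  by exists (fun=> 0); rewrite big_nil.
move=> /andP[xl ul]; rewrite span_cons; split.
  move=> /memv_addP[u /vlineP[a ->] [w /(IH w ul)[c ->] ->]].
  exists (fun y => if y == x then a else c y); rewrite big_cons eqxx; congr (_ + _).
  apply: eq_big_seq => y yl; case: eqP => // e.
  by rewrite -e yl in xl.
move=> [c ->]; rewrite big_cons memv_add ?memvZ ?memv_line //.
by apply/(IH _ ul); exists c.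
Qed.

Lemma dim_span_rcons (k : fieldType) (V : vectType k) (l : seq V) v :
  \dim <<rcons l v>> = (\dim <<l>> + (v \notin <<l>>%VS))%N.
Proof.
have e : (<<rcons l v>> = <<l>> + <[v]>)%VS by rewrite -cats1 span_cat span_seq1.
have [vl|vl] := boolP (v \in <<l>>%VS).
  by rewrite e addn0; congr (\dim _); apply/addv_idPl; rewrite -memvE.
rewrite e /= dimv_disjoint_sum; last first.
  apply/eqP; rewrite -subv0; apply/subvP => u /memv_capP[ul /vlineP[a ua]].
  rewrite memv0 ua; have [->|a0] := eqVneq a 0; first by rewrite scale0r.
  by case/negP: vl; rewrite -(scalerK a0 v) -ua memvZ.
rewrite dim_vline; suff -> : v != 0 by [].
by apply: contraNneq vl => ->; rewrite mem0v.
Qed.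

Section StandardBasis.
Variables (k : fieldType) (I : eqType) (lt : rel I).
Hypotheses (lt_irr : irreflexive lt) (lt_trans : transitive lt)
  (lt_total : forall x y, x != y -> lt x y || lt y x).

Definition span_below (V : vectType k) (f : I -> V) (s : seq I) (x : I) : {vspace V} :=
  <<map f (seq.filter (lt^~ x) s)>>%VS.

(** Vectors are added in increasing order: each raises the dimension by one exactly when it is
    outside the span of its predecessors. *)
Let dim_span_sorted (V : vectType k) (f : I -> V) s : sorted lt s ->
  count (fun x : I => f x \notin span_below f s x) s = \dim <<map f s>>.
Proof.
elim/last_ind: s => [|s x IH]; first by rewrite span_nil dimv0.
move=> ss; have ss' : sorted lt s.
  by move: ss; rewrite -cats1 => /cat_sorted2[].
have hx : all (fun y => lt y x) s.
  move: ss; rewrite -rev_sorted rev_rcons /= path_sortedE; last first.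
    by move=> a b c h1 h2; exact: lt_trans h2 h1.
  by rewrite all_rev => /andP[].
rewrite map_rcons dim_span_rcons -IH // -cats1 count_cat /= addn0; congr (_ + _)%N.
  apply: eq_in_count => y ys; rewrite /span_below cats1 filter_rcons.
  case: ifP => // xy; have := lt_trans xy (allP hx y ys).
  by rewrite lt_irr.
rewrite /span_below filter_cat /= lt_irr cats0; congr (~~ (_ \in <<map _ _>>%VS)).
exact/all_filterP.
Qed.

Lemma dim_span_count (V : vectType k) (f : I -> V) s : uniq s ->
  count (fun x : I => f x \notin span_below f s x) s = \dim <<map f s>>.
Proof.
move=> us; pose le x y := (x == y) || lt x y.
have le_tot : total le.
  by move=> x y; rewrite /le; case: eqVneq => //= xy; rewrite lt_total // orbT.
have ps := permEl (perm_sort le s).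
have sps := perm_mem ps.
have ss : sorted lt (sort le s).
  have le_trans : transitive le.
    move=> y x z /orP[/eqP -> //|xy] /orP[/eqP <-|yz]; rewrite /le ?xy ?orbT //.
    by rewrite (lt_trans xy yz) orbT.
  have := sort_sorted le_tot s; rewrite !sorted_pairwise // => h.
  have : pairwise [rel x y | (x != y) && le x y] (sort le s).
    by rewrite pairwise_relI -uniq_pairwise sort_uniq us.
  by apply: sub_pairwise => x y /=; rewrite /le; case: eqVneq.
rewrite -(eq_span (perm_mem (perm_map f ps))) -dim_span_sorted // -(permP ps).
apply: eq_count => x /=; rewrite /span_below.
by rewrite (eq_span (perm_mem (perm_map f (perm_filter (lt^~ x) ps)))).
Qed.

(* Greedy choice: the family elements that are not combinations of smaller ones form a basis. *)
Lemma count_standard (V : lmodType k) (e : I -> V) (s : seq I) d (b : 'I_d -> V) : uniq s ->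
  (forall x, x \in s -> exists c : 'I_d -> k, e x = \sum_i c i *: b i) ->
  (forall i, exists c : I -> k, b i = \sum_(y <- s) c y *: e y) ->
  (forall c : 'I_d -> k, \sum_i c i *: b i = 0 -> forall i, c i = 0) ->
  count (fun x => `[< ~ exists c : I -> k, e x = \sum_(y <- s | lt y x) c y *: e y >]) s = d.
Proof.
move=> us he hb indep.
(* Coordinates with respect to b move the count into row vectors of length d. *)
have [co hco] : exists co : I -> 'rV[k]_d,
    forall x, x \in s -> e x = \sum_i co x 0 i *: b i.
  have /choice[co h] (x : I) : exists c : 'rV[k]_d, x \in s -> e x = \sum_i c 0 i *: b i.
    have [xs|xs] := boolP (x \in s); last by exists 0.
    have [c hc] := he x xs; exists (\row_i c i) => _.
    by rewrite hc; apply: eq_bigr => i _; rewrite mxE.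
  by exists co.
have comb (p : pred I) (c : I -> k) : \sum_(y <- s | p y) c y *: e y
    = \sum_i (\sum_(y <- s | p y) c y *: co y) 0 i *: b i.
  transitivity (\sum_(y <- s | p y) \sum_i (c y * co y 0 i) *: b i).
    rewrite big_seq_cond [RHS]big_seq_cond; apply: eq_bigr => y /andP[ys _].
    by rewrite hco // scaler_sumr; apply: eq_bigr => i _; rewrite scalerA.
  rewrite exchange_big; apply: eq_bigr => i _ /=; rewrite summxE scaler_suml.
  by apply: eq_bigr => y _; rewrite mxE.
have inj (u v : 'rV[k]_d) : \sum_i u 0 i *: b i = \sum_i v 0 i *: b i -> u = v.
  move=> h; apply/rowP => i; apply/eqP; rewrite -subr_eq0; apply/eqP.
  apply: (indep (fun i => u 0 i - v 0 i)).
  by under eq_bigr do rewrite scalerBl; rewrite sumrB h subrr.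
have e1 : \dim <<map co s>> = d.
  have -> : <<map co s>>%VS = fullv.
    apply/eqP; rewrite eqEsubv subvf; apply/subvP => u _.
    rewrite (matrix_sum_delta u) big_ord1; apply: memv_suml => i _; apply: memvZ.
    apply/(span_mapP co _ us); have [c hc] := hb i; exists c; apply: inj.
    rewrite -(comb predT) -hc (bigD1 i) //= mxE !eqxx scale1r big1 ?addr0 // => l li.
    by rewrite mxE eqxx (negPf li) scale0r.
  by rewrite dimvf /dim /= mul1n.
rewrite -[RHS]e1 -(dim_span_count co us); apply: eq_in_count => x xs.
apply/asboolP/negP => h1 h2; apply: h1.
  have /(span_mapP co _ (filter_uniq _ us))[c hc] := h2.
  by exists c; rewrite hco // comb hc big_filter.
have [c hc] := h2; apply/(span_mapP co _ (filter_uniq _ us)); exists c.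
by apply: inj; rewrite big_filter -comb -hc hco.
Qed.

End StandardBasis.

(** * Weighted counting of monomials *)

Section Monomials.
Variable n : nat.
Implicit Types (m : multinom n) (v : 'I_n).

Definition mons (j : nat) : seq (multinom n) :=
  map (@bmnm n j.+1)
    (seq.filter (fun b : bmultinom n j.+1 => mdeg b == j) (enum {: bmultinom n j.+1})).

Lemma mem_mons j m : (m \in mons j) = (mdeg m == j).
Proof.
apply/mapP/eqP => [[m'] |mj]; first by rewrite mem_filter => /andP[/eqP e _] ->.
have hm : (mdeg m < j.+1)%N by rewrite mj.
by exists (BMultinom hm); rewrite // mem_filter mem_enum /= mj eqxx.
Qed.

Lemma uniq_mons j : uniq (mons j).
Proof. by rewrite map_inj_uniq ?filter_uniq -?enumT ?enum_uniq // => x y h; exact: val_inj. Qed.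

Lemma mons_raise j v :
  perm_eq [seq mnm_add m (mnm1 v) | m <- mons j] (seq.filter (fun m => (0 < m v)%N) (mons j.+1)).
Proof.
apply: uniq_perm; first by rewrite map_inj_uniq ?uniq_mons //; exact: addIm.
  by rewrite filter_uniq // uniq_mons.
move=> m; rewrite mem_filter mem_mons; apply/mapP/andP => [[m']|[mv mj]].
  by rewrite mem_mons => /eqP <- ->; rewrite mnmDE mdegD mdeg1 mnm1E eqxx !addn1.
have e : mnm_add (mnm_sub m (mnm1 v)) (mnm1 v) = m.
  by apply: submK; rewrite lep1mP -lt0n.
exists (mnm_sub m (mnm1 v)) => //.
by rewrite mem_mons -eqSS -(eqP mj) -{2}e mdegD mdeg1 addn1.
Qed.

(** Multiplication by x_v is a bijection onto the monomials divisible by x_v, and the other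
    monomials have weight zero. *)
Lemma sum_mons_raise j v (F : multinom n -> nat) :
  (\sum_(m <- mons j.+1) m v * F m =
   \sum_(m <- mons j) (m v).+1 * F (mnm_add m (mnm1 v)))%N.
Proof.
transitivity (\sum_(m <- seq.filter (fun m => (0 < m v)%N) (mons j.+1)) m v * F m)%N.
  rewrite big_filter [LHS](bigID (fun m => 0 < m v)%N) /= [X in (_ + X)%N]big1 ?addn0 //.
  by move=> m; case: (m v).
rewrite -(perm_big _ (mons_raise j v)) big_map; apply: eq_bigr => m _.
by rewrite mnmDE mnm1E eqxx addn1.
Qed.

(* The edge m -> m x_v has weight m_v + 1, the exponent of x_v in m x_v, so that a monomial of
   degree j + 1 receives total weight j + 1. *)
Definition exits (B : pred (multinom n)) (j : nat) : nat :=
  \sum_(m <- mons j | B m) \sum_(v | ~~ B (mnm_add m (mnm1 v))) (m v).+1.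

(** Double counting of weighted edges. A monomial of degree j emits total weight n + j; one of B in
    degree j + 1 receives j + 1, all from B since B is closed under division. The rest of the
    emitted weight leaves B. *)
Lemma count_exits (B : pred (multinom n)) j :
  (forall m v, B (mnm_add m (mnm1 v)) -> B m) ->
  (j.+1 * count B (mons j.+1) + exits B j = (n + j) * count B (mons j))%N.
Proof.
move=> hB; rewrite -!sum1_count !big_distrr /=.
have -> : (\sum_(m <- mons j.+1 | B m) j.+1 * 1 =
    \sum_(m <- mons j | B m) \sum_(v | B (mnm_add m (mnm1 v))) (m v).+1)%N.
  transitivity (\sum_(m <- mons j.+1) \sum_v m v * B m)%N.
    rewrite big_mkcond [LHS]big_seq [RHS]big_seq; apply: eq_bigr => m.
    rewrite mem_mons mdegE => /eqP <-; rewrite -big_distrl /=.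
    by case: (B m); rewrite ?muln1 ?muln0.
  rewrite exchange_big /=; under eq_bigr do rewrite sum_mons_raise.
  rewrite exchange_big [RHS]big_mkcond /=; apply: eq_bigr => m _.
  case: ifP => Bm.
    by rewrite [RHS]big_mkcond; apply: eq_bigr => v _; case: (B _); rewrite ?muln1 ?muln0.
  rewrite big1 // => v _; case e : (B _); last by rewrite muln0.
  by rewrite (hB _ _ e) in Bm.
rewrite /exits -big_split /= [LHS]big_seq_cond [RHS]big_seq_cond.
apply: eq_bigr => m /andP[]; rewrite mem_mons mdegE => /eqP <- _.
have -> : (n + \sum_i m i)%N = (\sum_i (m i).+1)%N.
  by rewrite -[X in (X + _)%N](card_ord n) -sum1_card -big_split.
rewrite muln1.
by rewrite [RHS](bigID (fun v => B (mnm_add m (mnm1 v)))).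
Qed.

Lemma Tstep_count n' (B : pred (multinom n)) : n = n'.+1 ->
  (forall m v, B (mnm_add m (mnm1 v)) -> B m) ->
  forall j, Tstep n' (fun j => (count B (mons j))%:R) j = (exits B j)%:R.
Proof.
move=> en hB j; have /(congr1 (fun x : nat => x%:R : rat)) := count_exits j hB.
have en' : (n + j)%:R = n'%:R + 1 + j%:R :> rat by rewrite en natrD natr1.
rewrite natrD !natrM en' -natr1 /Tstep => e.
by lra.
Qed.

Definition wt (c : nat) (m : multinom n) : nat := \sum_(v < n | (v < c)%N) m v.

Lemma wtD c m m' : wt c (mnm_add m m') = (wt c m + wt c m')%N.
Proof. by rewrite /wt -big_split /=; apply: eq_bigr => v _; rewrite mnmDE. Qed.

Lemma wt1 c v : wt c (mnm1 v) = (v < c)%N.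
Proof.
rewrite /wt; case vc: (v < c)%N.
  rewrite (bigD1 v vc) /= (mnm1E v v) eqxx big1 ?addn0 // => u /andP[_ uv].
  by rewrite mnm1E eq_sym (negPf uv).
by rewrite big1 // => u uc; rewrite mnm1E; case: eqP => // e; rewrite e uc in vc.
Qed.

Lemma wt_le_mdeg c m : (wt c m <= mdeg m)%N.
Proof.
rewrite mdegE /wt [leqRHS](bigID (fun v : 'I_n => v < c)%N) /=; exact: leq_addr.
Qed.

Lemma wt_full m : wt n m = mdeg m.
Proof. by rewrite mdegE /wt; apply: eq_bigl => v; rewrite ltn_ord. Qed.

Definition layer (c w j : nat) : nat := count (fun m => wt c m == w) (mons j).

Lemma layer_lt c w j : (j < w)%N -> layer c w j = 0%N.
Proof.
move=> jw; apply/eqP; rewrite -leqn0 leqNgt -has_count; apply/hasPn => m.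
rewrite mem_mons => /eqP mj; apply: contraTneq jw => <-.
by rewrite -leqNgt -mj wt_le_mdeg.
Qed.

Lemma layer_gt0 c w : (0 < c)%N -> (0 < n)%N -> (0 < layer c w w)%N.
Proof.
move=> c0 n0; rewrite -has_count; pose v := Ordinal n0.
apply/hasP; exists (mnm_muln (mnm1 v) w); first by rewrite mem_mons mdegMn mdeg1 mul1n.
elim: w => [|w IH]; first by rewrite mulm0n /wt big1 // => u _; rewrite mnm0E.
by rewrite mulmS wtD wt1 c0 (eqP IH).
Qed.

Lemma card_lt_ord c : (c <= n)%N -> #|fun v : 'I_n => (v < c)%N| = c.
Proof.
by move=> cn; rewrite -sum1_card -(big_ord_widen n (fun=> 1%N) cn) sum1_card card_ord.
Qed.

(** The same double count, restricted to the n - c variables that do not change the weight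
    [wt c]. *)
Lemma layer_step c w j : (c <= n)%N -> (w <= j)%N ->
  ((j.+1 - w) * layer c w j.+1 = (j - w + (n - c)) * layer c w j)%N.
Proof.
move=> cn wj; pose P := (fun v : 'I_n => ~~ (v < c)%N).
have hw m : wt c m = w -> \sum_(v | P v) m v = (mdeg m - w)%N.
  by move=> <-; rewrite mdegE /wt [in RHS](bigID (fun v : 'I_n => v < c)%N) /= addKn.
rewrite /layer -!sum1_count !big_distrr /=.
transitivity (\sum_(m <- mons j.+1) \sum_(v | P v) m v * (wt c m == w))%N.
  rewrite big_mkcond [LHS]big_seq [RHS]big_seq; apply: eq_bigr => m.
  rewrite mem_mons => /eqP mj; rewrite -big_distrl /=.
  by case: eqP => [/hw ->|_]; rewrite ?muln0 // mj.
rewrite exchange_big /=; under eq_bigr do rewrite sum_mons_raise.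
rewrite exchange_big [RHS]big_mkcond [LHS]big_seq [RHS]big_seq; apply: eq_bigr => m.
rewrite mem_mons => /eqP mj.
have -> : \sum_(v | P v) (m v).+1 * (wt c (mnm_add m (mnm1 v)) == w)
    = ((\sum_(v | P v) (m v).+1) * (wt c m == w))%N.
  rewrite big_distrl; apply: eq_bigr => v /negPf vc.
  by rewrite wtD wt1 vc addn0.
case: eqP => [/hw h|_]; rewrite ?muln0 // !muln1.
under eq_bigr do rewrite -add1n.
rewrite big_split /= h mj sum1_card addnC; congr (_ + _)%N.
have := cardC (fun v : 'I_n => (v < c)%N); rewrite card_ord => en.
by rewrite -[in RHS]en card_lt_ord // addKn.
Qed.

(** By [layer_step] consecutive values have the same ratio as those of the rising factorial; the
    constant x is read off at j = w. *)
Lemma layer_rising c w : (c < n)%N -> exists2 x : rat, 0 <= x &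
  forall j, (w <= j)%N -> (layer c w j)%:R = x * (rising w%:R (n - c).-1).[j%:R].
Proof.
move=> cn; have r0 : 0 < (rising w%:R (n - c).-1).[w%:R].
  by apply: rising_pos; rewrite ltrDl.
exists ((layer c w w)%:R / (rising w%:R (n - c).-1).[w%:R]).
  by rewrite divr_ge0 // ltW.
move=> j /subnKC <-; elim: (j - w)%N => [|i IH]; first by rewrite addn0 divfK // gt_eqF.
have i0 : i.+1%:R != 0 :> rat by rewrite pnatr_eq0.
apply: (mulfI i0).
have := layer_step (ltnW cn) (leq_addr i w).
rewrite -addnS !addKn => /(congr1 (fun x : nat => x%:R : rat)); rewrite !natrM => ->.
rewrite IH mulrCA [RHS]mulrCA; congr (_ * _).
have e1 : (w + i.+1)%:R - 1 = (w + i)%:R :> rat by rewrite addnS -natr1 addrK.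
have e2 l : (w + l)%:R - w%:R = l%:R :> rat by rewrite natrD addrAC subrr add0r.
have := rising_shift w%:R (n - c).-1 (w + i.+1)%:R; rewrite e1 e2 risingSr e2 => <-.
by rewrite natrD prednK ?subn_gt0 // mulrC.
Qed.

(** The monomials outside (x_0, ..., x_(c-1))^i, a basis of the quotient. *)
Definition below (c i : nat) : pred (multinom n) := fun m => (wt c m < i)%N.

Lemma belowD c i m m' : below c i (mnm_add m m') -> below c i m.
Proof. by rewrite /below wtD; apply: leq_ltn_trans; exact: leq_addr. Qed.

(** Only monomials of the top layer w can leave, through the first c variables; the weights m_v + 1
    of these edges add up to w + c. *)
Lemma exits_below c w j : (c <= n)%N -> exits (below c w.+1) j = ((w + c) * layer c w j)%N.
Proof.
move=> cn; rewrite /exits /layer -sum1_count big_distrr /= /below.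
rewrite (bigID (fun m => wt c m == w)) /= [X in (_ + X)%N]big1 ?addn0; last first.
  move=> m /andP[m1 m2]; apply: big1 => v; rewrite wtD wt1 -leqNgt.
  by move: m1 m2; case: (v < c)%N; lia.
rewrite (eq_bigl (fun m => wt c m == w)); last first.
  by move=> m; case: eqP => [->|]; rewrite ?ltnSn ?andbF.
apply: eq_bigr => m /eqP mw; rewrite muln1.
rewrite (eq_bigl (fun v : 'I_n => v < c)%N); last first.
  by move=> v; rewrite wtD wt1 mw; case: (v < c)%N; rewrite ?addn1 ?addn0 ?ltnSn ?ltnn.
under eq_bigr do rewrite -add1n.
rewrite big_split /= -/(wt c m) mw addnC; congr (_ + _)%N.
by rewrite sum1_card card_lt_ord.
Qed.

Lemma count_below c i j : count (below c i) (mons j) = (\sum_(w < i) layer c w j)%N.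
Proof.
have e w : layer c w j = (\sum_(m <- mons j) (wt c m == w))%N.
  by rewrite /layer -sum1_count big_mkcond; apply: eq_bigr => m _; case: eqP.
under [RHS]eq_bigr do rewrite e.
rewrite -sum1_count exchange_big big_mkcond /=; apply: eq_bigr => m _; rewrite /below.
case: ltnP => h.
  rewrite (bigD1 (Ordinal h)) //= eqxx big1 ?addn0 // => w.
  by rewrite -val_eqE eq_sym => /negPf /= ->.
by rewrite big1 // => w _; case: eqP => // e'; move: h; rewrite e' leqNgt ltn_ord.
Qed.

End Monomials.

(* The Hilbert function of S / (x_0, ..., x_(c-1))^i. *)
Definition hbelow (n c i : nat) : nat -> rat :=
  fun j => (count (below (n := n.+1) c i) (mons n.+1 j))%:R.

Lemma Tstep_hbelow n c w j : (c <= n.+1)%N ->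
  Tstep n (hbelow n c w.+1) j = ((w + c) * layer n.+1 c w j)%:R.
Proof.
move=> cn; rewrite /hbelow Tstep_count ?exits_below // => m v.
exact: belowD.
Qed.

(** For c = n.+1 the function vanishes from degree i on. Otherwise it is a sum of layers w < i, each
    polynomial of degree n - c < n from w on. *)
Lemma tail_hbelow n c i (a : int) : (0 < c <= n.+1)%N -> i%:Z <= a + 1 ->
  exists q, tail_poly n a (ext0 (hbelow n c i)) q.
Proof.
move=> /andP[c0 cn] ia; have [cltn|] := ltnP c n.+1; last first.
  move=> nc; have {nc cn} -> : c = n.+1 by apply/eqP; rewrite eqn_leq cn.
  exists 0; split; first by rewrite size_poly0.
  move=> [j|j] aj; rewrite horner0 //= /hbelow.
  have -> : count (below (n := n.+1) n.+1 i) (mons n.+1 j) = 0%N.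
    apply/eqP; rewrite -leqn0 leqNgt -has_count; apply/hasPn => m.
    by rewrite mem_mons /below wt_full => /eqP ->; lia.
  by [].
have ex w : exists x : rat,
    forall j, (w <= j)%N -> (layer n.+1 c w j)%:R = x * (rising w%:R (n.+1 - c).-1).[j%:R].
  by have [x _ h] := layer_rising w cltn; exists x.
have {ex}[x hx] := choice ex.
exists (\sum_(w < i) x w *: rising w%:R (n.+1 - c).-1); split.
  apply: (leq_trans (size_sum _ _ _)); apply/bigmax_leqP => w _.
  apply: (leq_trans (size_scale_leq _ _)); rewrite size_rising; lia.
case=> [j|j] aj; last by lia.
rewrite /= /hbelow count_below natr_sum horner_sum; apply: eq_bigr => w _.
rewrite hornerZ hx //; have := ltn_ord w; lia.
Qed.

(** * Graded modules generated in degree zero *)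

Section Graded.
Variables (k : fieldType) (n : nat).
Local Notation S := (polyring k n).

(* Restriction of scalars to k. *)
Definition kspace (M : lmodType S) : Type := M.

Section KSpace.
Variable M : lmodType S.
HB.instance Definition _ := GRing.Zmodule.on (kspace M).

Fact kspaceA (a b : k) (v : kspace M) :
  scal n a *: (scal n b *: (v : M)) = scal n (a * b) *: (v : M).
Proof. by rewrite scalerA /scal mpolyCM. Qed.

Fact kspace1 : left_id 1 (fun c (v : kspace M) => scal n c *: (v : M)).
Proof. by move=> v; rewrite /scal mpolyC1 scale1r. Qed.

Fact kspaceDr : right_distributive (fun c (v : kspace M) => scal n c *: (v : M)) +%R.
Proof. by move=> a u v; rewrite scalerDr. Qed.

Fact kspaceDl (v : kspace M) :
  {morph (fun c : k => scal n c *: (v : M)) : a b / a + b}.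
Proof. by move=> a b; rewrite /scal mpolyCD scalerDl. Qed.

HB.instance Definition _ :=
  GRing.Zmodule_isLmodule.Build k (kspace M) kspaceA kspace1 kspaceDr kspaceDl.
End KSpace.

Lemma mul_scalX (c : k) m : scal n c * mpolyX k m = c *: mpolyX k m.
Proof. by rewrite /scal mul_mpolyC. Qed.

Lemma homogeneous_scal (c : k) : @homogeneous k n 0 (scal n c).
Proof.
rewrite /homogeneous /scal /= dhomogE; apply/allP => m; rewrite msuppC.
by case: ifP => // _; rewrite mem_seq1 => /eqP -> /=; rewrite mdeg0.
Qed.

Lemma homogeneousX m : @homogeneous k n (mdeg m) (mpolyX k m).
Proof. by rewrite /homogeneous /= dhomogE msuppX /= eqxx. Qed.

Lemma mpoly_mons (p : S) N : (forall m, m \in msupp p -> (mdeg m < N)%N) ->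
  p = \sum_(d < N) \sum_(m <- mons n.+1 d) mcoeff m p *: mpolyX k m.
Proof.
move=> hp; apply/mpolyP => m; rewrite raddf_sum /=.
transitivity (\sum_(d < N) (mdeg m == d)%:R * mcoeff m p).
  have [mN|Nm] := ltnP (mdeg m) N.
    rewrite (bigD1 (Ordinal mN)) //= eqxx mul1r big1 ?addr0 // => d.
    by rewrite -val_eqE /= eq_sym => /negPf ->; rewrite mul0r.
  rewrite (_ : mcoeff m p = 0); first by rewrite big1 // => d _; rewrite mulr0.
  by apply/eqP; rewrite mcoeff_eq0; apply/negP => /hp; rewrite ltnNge Nm.
apply: eq_bigr => d _; rewrite raddf_sum /= -mem_mons.
have [md|md] := boolP (m \in mons n.+1 d).
  rewrite (bigD1_seq m) ?uniq_mons //= mcoeffZ mcoeffX eqxx mulr1 mul1r.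
  rewrite big1 ?addr0 // => m' m'm.
  by rewrite mcoeffZ mcoeffX (negPf m'm) mulr0.
rewrite mul0r big_seq big1 // => m' m'd; rewrite mcoeffZ mcoeffX.
by case: eqP => e; rewrite ?mulr0 // -e m'd in md *.
Qed.

Section GradedPieces.
Variable M : gradedModule k n.

Lemma piece_sum j (T : Type) (r : seq T) (P : pred T) (u : T -> M) :
  (forall i, P i -> piece j (u i)) -> piece j (\sum_(i <- r | P i) u i).
Proof.
by move=> h; elim/big_ind: _ => //; [exact: piece0 | move=> x y; exact: pieceD].
Qed.

Lemma piece_scal j c (x : M) : piece j x -> piece j (scal n c *: x).
Proof. by move=> h; rewrite -[j]add0n; apply: piece_scale h; exact: homogeneous_scal. Qed.

Lemma pieceX j m (x : M) : piece 0 x -> mdeg m = j -> piece j (mpolyX k m *: x).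
Proof. by move=> h <-; rewrite -[mdeg m]addn0; apply: piece_scale h; exact: homogeneousX. Qed.

Lemma piece_comp N (u : nat -> M) i (x : M) : (forall j, piece j (u j)) ->
  x = \sum_(j < N) u j -> piece i x -> (i < N)%N -> x = u i.
Proof.
move=> hu ex hx iN; apply/eqP; rewrite -subr_eq0 -oppr_eq0 opprB; apply/eqP.
(* Subtracting x in degree i gives a family of homogeneous elements with sum 0. *)
pose w j := u j + scal n (- (j == i)%:R) *: x.
suff : w i = 0.
  by rewrite /w eqxx /scal mpolyCN mpolyC1 scaleN1r.
apply: (@piece_direct _ _ M N) => // [j|].
  rewrite /w; have [->|_] := eqVneq j i; first by apply: pieceD => //; exact: piece_scal.
  by rewrite oppr0 /scal mpolyC0 scale0r addr0.
rewrite /w big_split /= -ex (bigD1 (Ordinal iN)) //= eqxx /scal mpolyCN mpolyC1 scaleN1r.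
rewrite addrA subrr add0r big1 // => j; rewrite -val_eqE /= => /negPf ->.
by rewrite oppr0 mpolyC0 scale0r.
Qed.

(** Indices (i, m) of the products x^m b_i of degree j. *)
Definition gens r j : seq ('I_r * multinom n.+1) :=
  [seq (i, m) | i <- enum 'I_r, m <- mons n.+1 j].

Lemma uniq_gens r j : uniq (gens r j).
Proof. by apply: allpairs_uniq; rewrite ?enum_uniq ?uniq_mons // => -[? ?] [? ?]. Qed.

Lemma mem_gens r j y : (y \in gens r j) = (mdeg y.2 == j).
Proof.
apply/allpairsP/idP => [[[i m] /= [_ hm ->]]|hy]; first by rewrite -mem_mons.
by exists y; rewrite mem_enum mem_mons; case: y hy.
Qed.

Lemma big_gens r j (V : zmodType) (F : 'I_r * multinom n.+1 -> V) :
  \sum_(y <- gens r j) F y = \sum_i \sum_(m <- mons n.+1 j) F (i, m).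
Proof. by rewrite /gens big_allpairs /= big_enum. Qed.

(** Splitting the f i into homogeneous components decomposes x by degree, and uniqueness leaves only
    the component of degree j. *)
Lemma piece_span r (b : 'I_r -> M) j (x : M) : (forall i, piece 0 (b i)) ->
  (exists f : 'I_r -> S, x = \sum_i f i *: b i) -> piece j x ->
  exists c : 'I_r * multinom n.+1 -> k,
    x = \sum_(y <- gens r j) scal n (c y) *: (mpolyX k y.2 *: b y.1).
Proof.
move=> hb [f hf] hx; pose N := (maxn j.+1 (\max_i mmeasure mdeg (f i)))%N.
pose c (y : 'I_r * multinom n.+1) := mcoeff y.2 (f y.1).
pose u d := \sum_(y <- gens r d) scal n (c y) *: (mpolyX k y.2 *: b y.1).
exists c; apply: (@piece_comp N u) hx _; last by rewrite /N leq_max leqnn.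
  move=> d; rewrite /u big_seq; apply: piece_sum => y; rewrite mem_gens => /eqP hy.
  by apply: piece_scal; exact: pieceX.
rewrite hf /u; under [RHS]eq_bigr do rewrite big_gens.
rewrite exchange_big; apply: eq_bigr => i _ /=.
rewrite {1}(@mpoly_mons (f i) N) => [|m hm]; last first.
  apply: (leq_trans (mmeasure_mnm_lt _ hm)); rewrite /N leq_max.
  by apply/orP; right; exact: (leq_bigmax i).
rewrite scaler_suml; apply: eq_bigr => d _; rewrite scaler_suml; apply: eq_bigr => m _.
by rewrite scalerA mul_scalX.
Qed.

(** Generator index first, then the monomial order: multiplying by a variable preserves this
    order. *)
Definition gens_lt r (y z : 'I_r * multinom n.+1) :=
  (y.1 < z.1)%N || ((y.1 == z.1) && (y.2 < z.2)%O).

Lemma gens_lt_irr r : irreflexive (@gens_lt r).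
Proof. by move=> y; rewrite /gens_lt ltnn ltxx andbF. Qed.

Lemma gens_lt_trans r : transitive (@gens_lt r).
Proof.
move=> y x z; rewrite /gens_lt => /orP[h1|/andP[/eqP -> h1]] /orP[h2|/andP[/eqP <- h2]].
- by rewrite (ltn_trans h1 h2).
- by rewrite h1.
- by rewrite h2.
- by rewrite eqxx (lt_trans h1 h2) orbT.
Qed.

Lemma gens_lt_total r (x y : 'I_r * multinom n.+1) : x != y -> gens_lt x y || gens_lt y x.
Proof.
move=> xy; rewrite /gens_lt; case: (ltngtP x.1 y.1) => [//|_|/ord_inj e] /=; first by rewrite orbT.
rewrite e eqxx /=; case: (ltgtP x.2 y.2) => [//|//|e2].
by rewrite (surjective_pairing x) (surjective_pairing y) e e2 eqxx in xy.
Qed.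

(** The analogue of the standard monomials of Groebner basis theory. *)
Definition standard r (e : 'I_r * multinom n.+1 -> M) (x : 'I_r * multinom n.+1) : bool :=
  `[< ~ exists c : 'I_r * multinom n.+1 -> k,
    e x = \sum_(y <- gens r (mdeg x.2) | gens_lt y x) scal n (c y) *: e y >].

Lemma kdim_standard r (e : 'I_r * multinom n.+1 -> M) j d :
  (forall y, y \in gens r j -> piece j (e y)) ->
  (forall x, piece j x -> exists c : 'I_r * multinom n.+1 -> k,
    x = \sum_(y <- gens r j) scal n (c y) *: e y) ->
  kdim (piece (g := M) j) d ->
  d = (\sum_i count (fun m => standard e (i, m)) (mons n.+1 j))%N.
Proof.
move=> he hspan [b [hb1 hb2 hb3]].
have := @count_standard k _ _ (@gens_lt_irr r) (@gens_lt_trans r) (@gens_lt_total r)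
  (kspace M) e (gens r j) d b (uniq_gens r j).
move=> <-; first last.
- exact: hb3.
- by move=> i; apply: hspan.
- by move=> y /he /hb2.
have -> : (\sum_i count (fun m => standard e (i, m)) (mons n.+1 j) =
    count (standard e) (gens r j))%N.
  rewrite -[RHS]sum1_count [RHS]big_mkcond /gens big_allpairs big_enum; apply: eq_bigr => i _.
  by rewrite -big_mkcond sum1_count.
by apply: eq_in_count => y; rewrite mem_gens /standard => /eqP ->.
Qed.

Lemma big_gens_raise r j v (V : zmodType) (F : 'I_r * multinom n.+1 -> V) :
  \sum_(y <- gens r j.+1 | (0 < y.2 v)%N) F y =
  \sum_(y <- gens r j) F (y.1, mnm_add y.2 (mnm1 v)).
Proof.
rewrite big_mkcond !big_gens /=; apply: eq_bigr => i _.
by rewrite -big_mkcond -big_filter -(perm_big _ (mons_raise j v)) big_map.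
Qed.

(** A relation expressing x^m b_i by smaller products, multiplied by x_v, is such a relation for x^m
    x_v b_i. *)
Lemma standard_down r (b : 'I_r -> M) i m v :
  standard (fun y => mpolyX k y.2 *: b y.1) (i, mnm_add m (mnm1 v)) ->
  standard (fun y => mpolyX k y.2 *: b y.1) (i, m).
Proof.
move=> /asboolP h; apply/asboolP => -[c hc]; apply: h => /=.
(* The coefficients of the multiplied relation, zero at indices not divisible by x_v. *)
exists (fun y : 'I_r * multinom n.+1 => if (0 < y.2 v)%N && gens_lt y (i, mnm_add m (mnm1 v))
                 then c (y.1, mnm_sub y.2 (mnm1 v)) else 0).
rewrite /= addmC mpolyXD -scalerA; rewrite /= in hc; rewrite {}hc.
rewrite mdegD mdeg1 add1n.
rewrite big_mkcond scaler_sumr [RHS]big_mkcond /=.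
rewrite [RHS](bigID (fun y : 'I_r * multinom n.+1 => 0 < y.2 v)%N) /=.
rewrite [X in _ + X]big1 ?addr0; last first.
  by move=> y hy; rewrite (negPf hy) /= /scal mpolyC0 scale0r if_same.
rewrite (big_gens_raise _ v); apply: eq_bigr => -[i' m'] _ /=.
rewrite mnmDE mnm1E eqxx addn1 /= addmK.
have -> : gens_lt (i', mnm_add m' (mnm1 v)) (i, mnm_add (mnm1 v) m) = gens_lt (i', m') (i, m).
  by rewrite /gens_lt /= [in LHS](addmC (mnm1 v)) ltmc_add2l.
case: ifP => // _; last by rewrite scaler0.
by rewrite addmC mpolyXD !scalerA mulrCA mulrA.
Qed.

Lemma generated_basis r (b : 'I_r -> M) : generated_in_degree_zero M ->
  (forall m, piece 0 m -> exists c : 'I_r -> k, m = \sum_i scal n (c i) *: b i) ->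
  forall m : M, exists f : 'I_r -> S, m = \sum_i f i *: b i.
Proof.
move=> hg hb m; have [s [c [g [hg0 ->]]]] := hg m.
have /choice[a ha] l : exists c : 'I_r -> k, g l = \sum_i scal n (c i) *: b i by exact: hb.
exists (fun i => \sum_l c l * scal n (a l i)).
under [RHS]eq_bigr do rewrite scaler_suml.
rewrite exchange_big; apply: eq_bigr => l _; rewrite ha scaler_sumr.
by apply: eq_bigr => i _; rewrite scalerA.
Qed.

(** For each generator the standard monomials are closed under division, so T of their count is the
    nonnegative number [exits]; h is the sum of these counts. *)
Lemma hilbert_Tstep_ge0 (h : nat -> rat) : generated_in_degree_zero M ->
  hilbert_function M h -> forall j, 0 <= Tstep n h j.
Proof.
move=> hg hh j; have [r hr0 _] := hh 0%N; have [b [hb1 hb2 _]] := hr0.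
pose e y := mpolyX k y.2 *: b y.1.
have hE i : h i = \sum_(l < r) (count (fun m => standard e (l, m)) (mons n.+1 i))%:R.
  have [d hd ->] := hh i; rewrite -natr_sum; congr (_%:R).
  apply: kdim_standard hd => [y|x hx].
    by rewrite mem_gens => /eqP hy; apply: pieceX => //; exact: hb1.
  by apply: piece_span => //; exact: generated_basis.
rewrite /Tstep !hE !mulr_sumr -sumrB; apply: sumr_ge0 => l _.
rewrite -/(Tstep n (fun i => (count (fun m => standard e (l, m)) (mons n.+1 i))%:R) j).
rewrite Tstep_count // => m v; exact: standard_down.
Qed.

End GradedPieces.
End Graded.

(** * Direct sums of monomial quotients *)

Section MonomialModule.
Variables (k : fieldType) (n : nat).
Local Notation S := (polyring k n).
Local Notation mon := (multinom n.+1).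

Record downset := Downset {
  down_mem :> pred mon;
  down_closed : forall m m', down_mem (mnm_add m m') -> down_mem m }.

Definition restr (P : pred mon) (p : S) : S :=
  \sum_(m <- msupp p | P m) mcoeff m p *: mpolyX k m.

Lemma mcoeff_restr P p m : mcoeff m (restr P p) = if P m then mcoeff m p else 0.
Proof.
rewrite /restr raddf_sum /= (eq_bigr (fun m' => mcoeff m p * (m' == m)%:R)); last first.
  by move=> m' _; rewrite mcoeffZ mcoeffX; case: eqP => [->|]; rewrite ?mulr0.
rewrite -mulr_sumr; have [mp|mp] := boolP (m \in msupp p); last first.
  by rewrite (memN_msupp_eq0 mp) mul0r if_same.
rewrite big_mkcond (bigD1_seq m) ?msupp_uniq //= eqxx big1 => [|m' /negPf ->].
  by case: ifP; rewrite addr0 ?mulr1 ?mulr0.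
by rewrite if_same.
Qed.

(** The monomials outside B span an ideal, so discarding them from p changes f * p only outside
    B. *)
Lemma mcoeff_mul_restr (B : downset) (f p : S) m : B m ->
  mcoeff m (f * restr B p) = mcoeff m (f * p).
Proof.
move=> Bm; rewrite !mcoeffM; apply: eq_bigr => -[m1 m2] /= /eqP e.
rewrite mcoeff_restr ifT //; apply: (@down_closed B _ m1).
by rewrite addmC -e.
Qed.

Lemma homogeneousP d (p : S) :
  homogeneous d p <-> forall m, mcoeff m p != 0 -> mdeg m = d.
Proof.
rewrite /homogeneous /= dhomogE; split=> [/allP h m|h].
  by rewrite -mcoeff_msupp => /h /= /eqP.
by apply/allP => m; rewrite mcoeff_msupp => /h /= ->.
Qed.

Variables (r : nat) (B : 'I_r -> downset).

Definition restr_ffun (v : {ffun 'I_r -> S}) : {ffun 'I_r -> S} :=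
  [ffun i => restr (B i) (v i)].

Definition restricted : {pred {ffun 'I_r -> S}} := [pred v | restr_ffun v == v].

Lemma restrictedP (v : {ffun 'I_r -> S}) :
  reflect (forall i m, ~~ B i m -> mcoeff m (v i) = 0) (v \in restricted).
Proof.
apply: (iffP eqP) => [<- i m /negPf nB|h]; first by rewrite ffunE mcoeff_restr nB.
apply/ffunP => i; apply/mpolyP => m; rewrite ffunE mcoeff_restr.
by case: ifPn => // /h ->.
Qed.

Fact restricted_closed : zmod_closed restricted.
Proof.
split=> [|u v /restrictedP hu /restrictedP hv].
  by apply/restrictedP => i m _; rewrite ffunE mcoeff0.
by apply/restrictedP => i m nB; rewrite !ffunE mcoeffB hu // hv // subr0.
Qed.

HB.instance Definition _ :=
  GRing.isZmodClosed.Build {ffun 'I_r -> S} restricted restricted_closed.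

(** The direct sum of the quotients of S by the monomial ideals complementary to the B i,
    represented by normal forms: tuples of polynomials supported on the B i. *)
Record monmod := MonMod { monmod_val :> {ffun 'I_r -> S}; _ : monmod_val \in restricted }.
HB.instance Definition _ := [isSub for monmod_val].
HB.instance Definition _ := [Choice of monmod by <:].
HB.instance Definition _ := [SubChoice_isSubZmodule of monmod by <:].

Fact restr_ffun_in v : restr_ffun v \in restricted.
Proof. by apply/restrictedP => i m /negPf nB; rewrite ffunE mcoeff_restr nB. Qed.

Definition mkmon v : monmod := MonMod (restr_ffun_in v).

Definition moncoef (v : monmod) i m := mcoeff m (v i).

Lemma moncoef_notin (v : monmod) i m : ~~ B i m -> moncoef v i m = 0.
Proof. exact: (restrictedP _ (valP v)). Qed.

Lemma moncoefP (u v : monmod) : (forall i m, B i m -> moncoef u i m = moncoef v i m) -> u = v.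
Proof.
move=> h; apply/val_inj/ffunP => i; apply/mpolyP => m.
have [/h //|nB] := boolP (B i m).
by rewrite -/(moncoef u i m) -/(moncoef v i m) !moncoef_notin.
Qed.

Lemma moncoef_mk w i m : B i m -> moncoef (mkmon w) i m = mcoeff m (w i).
Proof. by move=> h; rewrite /moncoef /= ffunE mcoeff_restr h. Qed.

Lemma moncoefD u v i m : moncoef (u + v) i m = moncoef u i m + moncoef v i m.
Proof. by rewrite /moncoef /= ffunE mcoeffD. Qed.

Lemma moncoef0 i m : moncoef 0 i m = 0.
Proof. by rewrite /moncoef /= ffunE mcoeff0. Qed.

Lemma moncoef_sum (T : Type) (s : seq T) (P : pred T) (F : T -> monmod) i m :
  moncoef (\sum_(x <- s | P x) F x) i m = \sum_(x <- s | P x) moncoef (F x) i m.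
Proof.
elim/big_rec2: _ => [|x u v _ <-]; first exact: moncoef0.
exact: moncoefD.
Qed.

Definition monscale (f : S) (v : monmod) : monmod := mkmon [ffun i => f * v i].

Lemma moncoef_scale f v i m : B i m -> moncoef (monscale f v) i m = mcoeff m (f * v i).
Proof. by move=> h; rewrite moncoef_mk // ffunE. Qed.

Fact monscaleA f g v : monscale f (monscale g v) = monscale (f * g) v.
Proof.
apply: moncoefP => i m h; rewrite !moncoef_scale //= !ffunE mcoeff_mul_restr //.
by rewrite mulrA.
Qed.

Fact monscale1 : left_id 1 monscale.
Proof. by move=> v; apply: moncoefP => i m h; rewrite moncoef_scale // mul1r. Qed.

Fact monscaleDr : right_distributive monscale +%R.
Proof.
move=> f u v; apply: moncoefP => i m h.
by rewrite moncoefD !moncoef_scale //= ffunE mulrDr mcoeffD.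
Qed.

Fact monscaleDl v : {morph monscale^~ v : f g / f + g}.
Proof.
move=> f g; apply: moncoefP => i m h.
by rewrite moncoefD !moncoef_scale //= mulrDl mcoeffD.
Qed.

HB.instance Definition _ :=
  GRing.Zmodule_isLmodule.Build S monmod monscaleA monscale1 monscaleDr monscaleDl.

Lemma moncoefZ f (v : monmod) i m : B i m -> moncoef (f *: v) i m = mcoeff m (f * v i).
Proof. exact: moncoef_scale. Qed.

Lemma moncoef_scal c (v : monmod) i m : moncoef (scal n c *: v) i m = c * moncoef v i m.
Proof.
have [h|h] := boolP (B i m); last by rewrite !moncoef_notin // mulr0.
by rewrite moncoefZ // /scal mcoeffCM.
Qed.

Definition monpiece (j : nat) : set monmod :=
  [set v | forall i m, moncoef v i m != 0 -> mdeg m = j].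

Fact monpiece0 j : monpiece j 0.
Proof. by move=> i m; rewrite moncoef0 eqxx. Qed.

Fact monpieceD j u v : monpiece j u -> monpiece j v -> monpiece j (u + v).
Proof.
move=> hu hv i m; rewrite moncoefD; have [->|/hu //] := eqVneq (moncoef u i m) 0.
by rewrite add0r; exact: hv.
Qed.

Fact monpiece_exhaust v : exists N (u : nat -> monmod),
  (forall j, monpiece j (u j)) /\ v = \sum_(j < N) u j.
Proof.
pose w j := mkmon [ffun i => restr [pred m | mdeg m == j] (v i)].
have wE j i m : B i m -> moncoef (w j) i m = if mdeg m == j then moncoef v i m else 0.
  by move=> h; rewrite moncoef_mk // ffunE mcoeff_restr.
exists (\max_i mmeasure mdeg (v i)), w; split.
  move=> j i m; have [h|/moncoef_notin ->] := boolP (B i m); last by rewrite eqxx.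
  by rewrite wE //; case: ifP => [/eqP //|_]; rewrite eqxx.
apply: moncoefP => i m h; rewrite moncoef_sum.
rewrite (eq_bigr _ (fun j _ => wE (val j) i m h)) -big_mkcond /=.
have [/memN_msupp_eq0 e|] := boolP (m \notin msupp (v i)).
  by rewrite /moncoef e big1.
rewrite negbK => /(@mmeasure_mnm_lt _ _ mdeg) hm.
have hN : (mdeg m < \max_i mmeasure mdeg (v i))%N.
  by apply: leq_trans hm _; exact: (leq_bigmax i).
by rewrite (big_pred1 (Ordinal hN)) // => j; rewrite -val_eqE eq_sym.
Qed.

Fact monpiece_direct N (u : nat -> monmod) : (forall j, monpiece j (u j)) ->
  \sum_(j < N) u j = 0 -> forall j, (j < N)%N -> u j = 0.
Proof.
move=> hu h0 j jN; apply: moncoefP => i m _; rewrite moncoef0; apply/eqP/negPn/negP => hm.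
have mj := hu j i m hm; case/negP: hm; apply/eqP.
have := congr1 (fun v => moncoef v i m) h0; rewrite moncoef0 moncoef_sum.
rewrite (bigD1 (Ordinal jN)) //= big1 ?addr0 // => l lj.
apply/eqP/negPn/negP => /hu e; case/negP: lj.
by rewrite -val_eqE /= -e mj.
Qed.

Fact monpiece_scale d j (f : S) (v : monmod) :
  homogeneous d f -> monpiece j v -> monpiece (d + j) (f *: v).
Proof.
move=> /homogeneousP hf hv i m; have [h|/moncoef_notin ->] := boolP (B i m); last by rewrite eqxx.
rewrite moncoefZ // mcoeffM; apply: contra_neq_eq => hm.
apply: big1 => -[m1 m2] /= /eqP e.
have [->|/hf h1] := eqVneq (mcoeff m1 f) 0; first by rewrite mul0r.
have [->|/(hv i) h2] := eqVneq (mcoeff m2 (v i)) 0; first by rewrite mulr0.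
by rewrite e mdegD h1 h2 eqxx in hm.
Qed.

Definition mongraded : gradedModule k n :=
  GradedModule monpiece0 monpieceD monpiece_exhaust monpiece_direct monpiece_scale.

Definition mongen (i : 'I_r) : monmod := mkmon [ffun l => if l == i then 1 else 0].

Lemma mongen_piece i : monpiece 0 (mongen i).
Proof.
move=> l m; have [h|/moncoef_notin ->] := boolP (B l m); last by rewrite eqxx.
rewrite moncoef_mk // ffunE; case: (l =P i) => _; last by rewrite mcoeff0 eqxx.
rewrite mcoeff1; case: (m =P mnm0) => [->|_]; last by rewrite eqxx.
by rewrite mdeg0.
Qed.

Lemma mongen_span (v : monmod) : v = \sum_i (v i : S) *: mongen i.
Proof.
apply: moncoefP => l m h; rewrite moncoef_sum (bigD1 l) //= big1 ?addr0.
  by rewrite moncoefZ //= ffunE mcoeff_mul_restr // ffunE eqxx mulr1.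
by move=> i /negPf il; rewrite moncoefZ //= ffunE mcoeff_mul_restr // ffunE eq_sym il mulr0 mcoeff0.
Qed.

Lemma mongraded_fg : finitely_generated mongraded.
Proof. by exists r, mongen => v; exists v; exact: mongen_span. Qed.

Lemma mongraded_gen0 : generated_in_degree_zero mongraded.
Proof.
by move=> v; exists r, v, mongen; split; [exact: mongen_piece | exact: mongen_span].
Qed.

(** Every multiple of a monomial outside B i is again outside B i. *)
Lemma mongraded_annihilator u : (forall i, ~~ B i u) -> annihilator mongraded (mpolyX k u).
Proof.
move=> hu v; apply: moncoefP => i m h; rewrite moncoef0 moncoefZ // mcoeffM.
apply: big1 => -[m1 m2] /= /eqP e; rewrite mcoeffX.
case: eqP => [eu|_]; last by rewrite mul0r.
by case/negP: (hu i); apply: (@down_closed (B i) _ m2); rewrite eu -e.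
Qed.

Definition monbasis j : seq ('I_r * mon) := [seq y <- gens n r j | B y.1 y.2].

Definition monelt (y : 'I_r * mon) : monmod :=
  mkmon [ffun i => if i == y.1 then mpolyX k y.2 else 0].

Lemma moncoef_elt y i m : B i m -> moncoef (monelt y) i m = (y == (i, m))%:R.
Proof.
move=> h; rewrite moncoef_mk // ffunE; case: y => i' m' /=.
rewrite xpair_eqE eq_sym; case: eqP => _; last by rewrite mcoeff0.
by rewrite mcoeffX.
Qed.

Lemma mongraded_kdim j : kdim (piece (g := mongraded) j) (size (monbasis j)).
Proof.
have hB l : B (tnth (in_tuple (monbasis j)) l).1 (tnth (in_tuple (monbasis j)) l).2.
  by have := mem_tnth l (in_tuple (monbasis j)); rewrite mem_filter => /andP[].
have hu : uniq (monbasis j) by rewrite filter_uniq // uniq_gens.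
exists (fun l => monelt (tnth (in_tuple (monbasis j)) l)); split.
- move=> l i m; have [h|/moncoef_notin ->] := boolP (B i m); last by rewrite eqxx.
  rewrite moncoef_elt //; case: (_ =P (i, m)) => [e _|_]; last by rewrite eqxx.
  have := mem_tnth l (in_tuple (monbasis j)).
  by rewrite e mem_filter mem_gens => /andP[_ /eqP].
- move=> v hv; exists (fun l => moncoef v (tnth (in_tuple (monbasis j)) l).1
                                    (tnth (in_tuple (monbasis j)) l).2).
  rewrite -(big_tnth _ _ (monbasis j) predT
    (fun y => scal n (moncoef v y.1 y.2) *: monelt y)).
  apply: moncoefP => i m h; rewrite moncoef_sum.
  have e y : moncoef (scal n (moncoef v y.1 y.2) *: monelt y) i m
      = moncoef v i m * (y == (i, m))%:R.
    by rewrite moncoef_scal moncoef_elt //; case: eqP => [->|]; rewrite ?mulr0.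
  under eq_bigr do rewrite e.
  rewrite -mulr_sumr; have [->|vim] := eqVneq (moncoef v i m) 0; first by rewrite mul0r.
  have im : (i, m) \in monbasis j by rewrite mem_filter h mem_gens /= (hv _ _ vim) eqxx.
  rewrite (bigD1_seq (i, m)) //= eqxx big1 ?addr0 ?mulr1 // => y /negPf ->.
  by [].
move=> c h0 l; have := congr1 (fun v => moncoef v (tnth (in_tuple (monbasis j)) l).1
                                    (tnth (in_tuple (monbasis j)) l).2) h0.
rewrite moncoef0 moncoef_sum (bigD1 l) //= moncoef_scal moncoef_elt //.
rewrite -surjective_pairing eqxx mulr1 big1 ?addr0 // => l' l'l.
rewrite moncoef_scal moncoef_elt // -surjective_pairing.
case: eqP => [e|_]; last by rewrite mulr0.
have inj := elimT (tuple_uniqP (in_tuple (monbasis j))) hu.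
by rewrite (inj _ _ e) eqxx in l'l.
Qed.

Lemma mongraded_hilbert :
  hilbert_function mongraded (fun j => \sum_i (count (B i) (mons n.+1 j))%:R).
Proof.
move=> j; exists (size (monbasis j)); first exact: mongraded_kdim.
rewrite -natr_sum; congr (_%:R).
rewrite size_filter -[RHS]sum1_count /gens [RHS]big_mkcond big_allpairs big_enum /=.
by apply: eq_bigr => i _; rewrite -big_mkcond sum1_count.
Qed.

End MonomialModule.

(** * Quotients by powers of the irrelevant ideal *)

Section CyclicQuotient.
Variables (k : fieldType) (n : nat).
Local Notation S := (polyring k n).

Definition order_ge (i : nat) (f : S) := forall m, (mdeg m < i)%N -> mcoeff m f = 0.

Lemma order_geM a b f g : order_ge a f -> order_ge b g -> order_ge (a + b) (f * g).
Proof.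
move=> hf hg m hm; rewrite mcoeffM; apply: big1 => -[m1 m2] /= /eqP e.
have [/hf ->|h1] := ltnP (mdeg m1) a; first by rewrite mul0r.
have [/hg ->|h2] := ltnP (mdeg m2) b; first by rewrite mulr0.
by have := leq_add h1 h2; rewrite -mdegD -e leqNgt hm.
Qed.

Lemma order_ge_sum i r (F : 'I_r -> S) :
  (forall l, order_ge i (F l)) -> order_ge i (\sum_l F l).
Proof. by move=> h m hm; rewrite raddf_sum big1 // => l _; exact: h. Qed.

Lemma order_ge_span i (X : set S) f : (forall g, X g -> order_ge i g) ->
  ideal_span X f -> order_ge i f.
Proof.
move=> hX [r [c [g [hg ->]]]]; apply: order_ge_sum => l.
by rewrite -[i]add0n; apply: order_geM => //; exact: hX.
Qed.

Lemma order_ge_irrelevant f : @irrelevant k n f -> order_ge 1 f.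
Proof.
apply: order_ge_span => _ [v _ <-] m; rewrite ltnS leqn0 mdeg_eq0 => /eqP ->.
by rewrite /var mcoeffX mnm1_eq0.
Qed.

Lemma mpolyX_irrelevant_exp i (m : multinom n.+1) : (i <= mdeg m)%N ->
  exists (c : S) (g : nat -> S), (forall l, @irrelevant k n (g l)) /\
    mpolyX k m = c * \prod_(l < i) g l.
Proof.
elim: i m => [|i IH] m hm.
  exists (mpolyX k m), (fun=> 0); split; last by rewrite big_ord0 mulr1.
  move=> _; exists 0%N, (fun=> 0), (fun=> 0); split; first by case.
  by rewrite big_ord0.
have [v mv] : exists v, m v != 0%N.
  apply/existsP; apply: contraTT hm => /existsPn h.
  rewrite -leqNgt mdegE big1 // => v _; apply/eqP/negPn.
  exact: h.
have e : mnm_add (mnm_sub m (mnm1 v)) (mnm1 v) = m by apply: submK; rewrite lep1mP.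
have [|c [g [hg hc]]] := IH (mnm_sub m (mnm1 v)).
  by move: hm; rewrite -{1}e mdegD mdeg1 addn1 ltnS.
exists c, (fun l => if l == i then var k v else g l); split.
  move=> l; case: ifP => // _; exists 1%N, (fun=> 1), (fun=> var k v).
  by rewrite big_ord1 mul1r; split=> // _; exists v.
rewrite -{1}e mpolyXD hc big_ord_recr /= eqxx mulrA; congr (_ * _ * _).
by apply: eq_bigr => l _; rewrite ltn_eqF.
Qed.

(** Orders add under multiplication; conversely i variables can be split off each monomial of degree
    at least i. *)
Lemma ideal_exp_irrelevantP i f : ideal_exp (@irrelevant k n) i f <-> order_ge i f.
Proof.
split; first apply: order_ge_span => g [h [hh ->]].
  elim: i h hh => [|i IH] h hh; first by move=> m.
  rewrite big_ord_recr /= -[X in order_ge X]addn1.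
  apply: order_geM; last exact: order_ge_irrelevant.
  by apply: IH => l.
move=> hf.
have hm (l : 'I_(size (msupp f))) : (i <= mdeg (tnth (in_tuple (msupp f)) l))%N.
  have := mem_tnth l (in_tuple (msupp f)); rewrite /= mcoeff_msupp leqNgt.
  by apply: contra => /hf ->.
have /choice[cg hcg] (l : 'I_(size (msupp f))) : exists cg : S * (nat -> S),
    (forall l', @irrelevant k n (cg.2 l')) /\
    mpolyX k (tnth (in_tuple (msupp f)) l) = cg.1 * \prod_(l' < i) cg.2 l'.
  by have [c [g h]] := mpolyX_irrelevant_exp (hm l); exists (c, g).
exists (size (msupp f)).
exists (fun l => scal n (mcoeff (tnth (in_tuple (msupp f)) l) f) * (cg l).1).
exists (fun l => \prod_(l' < i) (cg l).2 l'); split=> [l|].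
  by exists (fun l' => (cg l).2 l'); split=> // l'; have [] := hcg l.
rewrite {1}(mpolyE f) (big_tnth _ _ (msupp f)); apply: eq_bigr => l _.
by rewrite -mulrA -(hcg l).2 mul_scalX.
Qed.

Definition belowset c i : downset n := Downset (@belowD n.+1 c i).

Section Map.
Variable i : nat.
Let B (l : 'I_1) := belowset n.+1 i.

Definition cycmap (f : S^o) : mongraded k B := mkmon B [ffun _ => f : S].

Fact cycmap_linear : linear cycmap.
Proof.
move=> a f g; apply: moncoefP => l m h.
rewrite moncoefD moncoefZ // !moncoef_mk //= !ffunE mcoeff_mul_restr //.
by rewrite mcoeffD.
Qed.

HB.instance Definition _ := GRing.isLinear.Build S S^o (mongraded k B) _ cycmap cycmap_linear.

Lemma cyclic_quotient_exists : exists M : gradedModule k n,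
  is_cyclic_quotient (ideal_exp (@irrelevant k n) i) M /\
  hilbert_function M (hbelow n n.+1 i).
Proof.
exists (mongraded k B); split; last first.
  suff -> : hbelow n n.+1 i = (fun j => \sum_(l < 1) (count (B l) (mons n.+1 j))%:R).
    exact: mongraded_hilbert.
  by apply/funext => j; rewrite big_ord1.
have hB l m : B l m = (mdeg m < i)%N by rewrite /B /= /below wt_full.
exists cycmap; split=> [v|d f hf l m|f].
- exists (v ord0); apply: moncoefP => l m h.
  by rewrite moncoef_mk // ffunE (ord1 l).
- have [h|/moncoef_notin ->] := boolP (B l m); last by rewrite eqxx.
  by rewrite moncoef_mk // ffunE; move/homogeneousP: hf => hf; exact: hf.
rewrite ideal_exp_irrelevantP; split=> [h0 m hm|h0].
  have := congr1 (fun v => moncoef v ord0 m) h0.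
  by rewrite moncoef0 moncoef_mk ?hB // ffunE.
apply: moncoefP => l m h; rewrite moncoef0 moncoef_mk // ffunE h0 //.
by rewrite -(hB l).
Qed.

End Map.

(** The standard monomials on the generator phi 1 are those of degree below i: the others map to 0,
    and a relation for a monomial of degree j < i would put a polynomial with a nonzero term of
    degree j into the ideal. *)
Lemma cyclic_quotient_hilbert i (M : gradedModule k n) (h : nat -> rat) :
  is_cyclic_quotient (ideal_exp (@irrelevant k n) i) M -> hilbert_function M h ->
  h = hbelow n n.+1 i.
Proof.
move=> [phi [hsurj hhom hker]] hh; apply/funext => j.
have [d hd ->] := hh j; congr (_%:R).
pose b (l : 'I_1) : M := phi 1.
pose e (y : 'I_1 * multinom n.+1) : M := mpolyX k y.2 *: b y.1.
have b0 l : piece 0 (b l).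
  by apply: hhom; rewrite -[1]/(scal n 1); exact: homogeneous_scal.
have phiE f : phi f = f *: b ord0 by rewrite -linearZ /= /GRing.scale /= mulr1.
have -> : d = (\sum_(l < 1) count (fun m => standard e (l, m)) (mons n.+1 j))%N.
  apply: kdim_standard hd => [y|x hx].
    by rewrite mem_gens => /eqP hy; exact: pieceX.
  apply: piece_span => //; have [f <-] := hsurj x.
  by exists (fun=> f); rewrite big_ord1.
rewrite big_ord1; apply: eq_in_count => m; rewrite mem_mons => /eqP mj.
rewrite /below wt_full mj; apply/asboolP/idP => [|ji].
  apply: contra_notT; rewrite -leqNgt => ij; exists (fun=> 0).
  rewrite big1 => [|y _]; last by rewrite /scal mpolyC0 scale0r.
  rewrite /e /= -phiE; apply/hker/ideal_exp_irrelevantP => m' hm'.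
  rewrite mcoeffX; case: eqP => // em; move: hm'.
  by rewrite -em mj ltnNge ij.
move=> [c /= hc].
pose f : S := mpolyX k m - \sum_(y <- gens n 1 j | gens_lt y (ord0, m)) c y *: mpolyX k y.2.
have f0 : phi f = 0.
  rewrite phiE scalerBl -[b ord0]/(b (ord0, m).1) -/(e (ord0, m)) hc mj scaler_suml -sumrB.
  apply: big1 => y _; rewrite /e scalerA mul_scalX subrr //.
have /hker/ideal_exp_irrelevantP/(_ m) := f0; rewrite mj => /(_ ji) /eqP.
rewrite mcoeffB mcoeffX eqxx raddf_sum big1 /= ?subr0 ?oner_eq0 // => y hy.
rewrite mcoeffZ mcoeffX; case: eqP => [em|]; last by rewrite mulr0.
by move: hy; rewrite /gens_lt (ord1 y.1) em ltnn ltxx andbF.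
Qed.

End CyclicQuotient.

(** * Krull dimension *)

(** Exponent vectors of length m with entries below D. *)
Fixpoint words (D m : nat) : seq (seq nat) :=
  if m is m'.+1 then [seq e :: s | e <- iota 0 D, s <- words D m'] else [:: [::]].

Lemma size_words D m : size (words D m) = (D ^ m)%N.
Proof. by elim: m => //= m IH; rewrite size_allpairs size_iota IH expnS. Qed.

Lemma uniq_words D m : uniq (words D m).
Proof.
elim: m => //= m IH; apply: allpairs_uniq; rewrite ?iota_uniq //.
by move=> [? ?] [? ?] _ _ /= [-> ->].
Qed.

Section Krull.
Variables (k : fieldType) (n : nat).
Local Notation S := (polyring k n).

Fixpoint ymon (y : nat -> S) (s : seq nat) : S :=
  if s is e :: s' then y 0%N ^+ e * ymon (fun i => y i.+1) s' else 1.

Lemma prime_expr (P : {pred S}) u e v : idealr_closed P -> prime_idealr_closed P ->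
  u \notin P -> u ^+ e * v \in P -> v \in P.
Proof.
move=> _ hP hu; elim: e v => [|e IH] v; first by rewrite mul1r.
by rewrite exprSr -mulrA => /IH /hP; rewrite (negPf hu).
Qed.

(* A vanishing polynomial in the y_i, divided by the largest power of y_0 that occurs, gives a
   vanishing polynomial in y_1, y_2, ... modulo the next prime of the chain. *)
Lemma prime_chain_independent D m (P : nat -> {pred S}) (y : nat -> S) (c : seq nat -> k) :
  (forall i, (i <= m)%N -> idealr_closed (P i) /\ prime_idealr_closed (P i)) ->
  (forall i, (i < m)%N -> [/\ {subset P i <= P i.+1}, y i \in P i.+1 & y i \notin P i]) ->
  \sum_(s <- words D m) c s *: ymon y s \in P 0%N -> forall s, s \in words D m -> c s = 0.
Proof.
elim: m P y c => [|m IH] P y c hP hy h0.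
  move=> s; rewrite mem_seq1 => /eqP ->; apply/eqP/negPn/negP => c0.
  have [[P0 P1 PD] _] := hP 0%N (leqnn _); case/negP: P1.
  have := PD (mpolyC n.+1 (c [::])^-1) _ _ h0 P0.
  by rewrite big_seq1 addr0 mul_mpolyC scalerA mulVf // scale1r.
have [P01 y1 y0] := hy 0%N (ltn0Sn _).
have [id1 _] := hP 1%N (ltn0Sn _); have [id0 pr0] := hP 0%N (leq0n _).
(* The coefficient of y_0^e, a polynomial in the later y_i. *)
pose A e := \sum_(s <- words D m) c (e :: s) *: ymon (fun i => y i.+1) s.
have hA e : A e \in P 1%N -> forall s, s \in words D m -> c (e :: s) = 0.
  apply: (IH (fun i => P i.+1)) => i im; first exact: hP.
  exact: hy.
have e0 : \sum_(s <- words D m.+1) c s *: ymon y s = \sum_(0 <= e < D) y 0%N ^+ e * A e.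
  rewrite /= big_allpairs_dep /index_iota subn0; apply: eq_bigr => e _.
  by rewrite mulr_sumr; apply: eq_bigr => s _; rewrite scalerAr.
have key e : (e <= D)%N -> forall e', (e' < e)%N -> A e' \in P 1%N.
  elim: e => // e IHe eD e'; rewrite ltnS leq_eqVlt => /orP[/eqP ->|]; last exact/IHe/ltnW.
  have : y 0%N ^+ e * \sum_(e <= l < D) y 0%N ^+ (l - e) * A l \in P 0%N.
    have -> : y 0%N ^+ e * \sum_(e <= l < D) y 0%N ^+ (l - e) * A l =
        \sum_(e <= l < D) y 0%N ^+ l * A l.
      rewrite mulr_sumr big_nat [RHS]big_nat.
      by apply: eq_bigr => l /andP[el _]; rewrite mulrA -exprD subnKC.
    (* The terms below e vanish: their A l lie in P 1, so all their coefficients are zero. *)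
    move: h0; rewrite e0 (big_cat_nat (leq0n e) (ltnW eD)) /=.
    rewrite [X in X + _]big_nat_cond big1 ?add0r //.
    move=> l /andP[/andP[_ le] _].
    rewrite /A big_seq big1 ?mulr0 // => s hs; rewrite (hA l _ s hs) ?scale0r //.
    by apply: IHe le; exact: ltnW.
  (* The power y_0^e cancels modulo the prime P 0; since y_0 is in P 1, only A e remains modulo P
     1. *)
  move=> /(prime_expr id0 pr0 y0); rewrite big_ltn // subnn mul1r => /P01.
  rewrite big_nat (eq_bigr (fun l => (y 0%N ^+ (l - e.+1) * A l) * y 0%N)); last first.
    move=> l /andP[el _]; rewrite mulrAC -exprSr; congr (_ ^+ _ * _); lia.
  rewrite -mulr_suml; set Z := \sum_(_ <= _ < _ | _) _ => hZ.
  case: id1 => _ _ /(_ (- Z) _ _ y1 hZ).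
  by rewrite addrCA mulNr addNr addr0.
move=> s /allpairsP[[e s'] /= [he hs ->]]; apply: hA hs.
by apply: (key D) => //; move: he; rewrite mem_iota.
Qed.

Definition deg_le (E : nat) (p : S) := forall m, mcoeff m p != 0 -> (mdeg m <= E)%N.

Lemma deg_le1 : deg_le 0 1.
Proof.
by move=> m; rewrite mcoeff1; case: (m =P mnm0) => [->|_]; rewrite ?mdeg0 ?eqxx.
Qed.

Lemma deg_leM a b p q : deg_le a p -> deg_le b q -> deg_le (a + b) (p * q).
Proof.
move=> hp hq m; apply: contraR => hm; rewrite mcoeffM; apply/eqP.
apply: big1 => -[m1 m2] /= /eqP e.
have [->|/hp h1] := eqVneq (mcoeff m1 p) 0; first by rewrite mul0r.
have [->|/hq h2] := eqVneq (mcoeff m2 q) 0; first by rewrite mulr0.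
by case/negP: hm; rewrite {1}e mdegD leq_add.
Qed.

Lemma deg_leX a p e : deg_le a p -> deg_le (a * e) (p ^+ e).
Proof.
move=> hp; elim: e => [|e IH]; first by rewrite muln0; exact: deg_le1.
by rewrite exprS mulnS; exact: deg_leM.
Qed.

Lemma deg_leW a b p : (a <= b)%N -> deg_le a p -> deg_le b p.
Proof. by move=> ab h m /h; move/leq_trans; apply. Qed.

Lemma deg_le_ymon D E m (y : nat -> S) s : (forall i, (i < m)%N -> deg_le E (y i)) ->
  s \in words D m -> deg_le (m * (E * D)) (ymon y s).
Proof.
elim: m y s => [|m IH] y s hy; first by rewrite mem_seq1 => /eqP ->; exact: deg_le1.
move=> /allpairsP[[e s'] /= [he hs ->]] /=; rewrite mulSn; apply: deg_leM.
  apply: (@deg_leW (E * e)); last by apply: deg_leX; exact: hy.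
  by rewrite leq_mul2l; move: he; rewrite mem_iota add0n => /= /ltnW ->; rewrite orbT.
by apply: IH => // i im; apply: hy.
Qed.

(** Monomials of degree at most T have all exponents at most T, so at most (T + 1)^(n + 1)
    coefficients are involved. *)
Lemma deg_bounded_dependent (T L : nat) (F : 'I_L -> S) :
  (forall l, deg_le T (F l)) -> (T.+1 ^ n.+1 < L)%N ->
  exists2 c : 'I_L -> k, (exists l, c l != 0) & \sum_l c l *: F l = 0.
Proof.
move=> hF hL; pose I := {ffun 'I_n.+1 -> 'I_T.+1}.
pose mu (g : I) : multinom n.+1 := Multinom [tuple nat_of_ord (g i) | i < n.+1].
pose A : 'M[k]_(L, #|{: I}|) := \matrix_(l, g) mcoeff (mu (enum_val g)) (F l).
have /rowV0Pn[v /sub_kermxP vA v0] : kermx A != 0.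
  rewrite kermx_eq0 /row_free; apply: contraTneq hL => rA.
  rewrite -leqNgt -[X in (X <= _)%N]rA; apply: leq_trans (rank_leq_col A) _.
  by rewrite card_ffun !card_ord.
exists (fun l => v 0 l).
  apply/existsP; apply: contraR v0 => /existsPn h; apply/eqP/rowP => l.
  by rewrite mxE; apply/eqP/negPn/h.
apply/mpolyP => m; rewrite mcoeff0 raddf_sum /=.
have [mT|Tm] := leqP (mdeg m) T; last first.
  rewrite big1 // => l _; rewrite mcoeffZ; have [->|/(hF l)] := eqVneq (mcoeff m (F l)) 0.
    by rewrite mulr0.
  by rewrite leqNgt Tm.
pose g : I := [ffun i => inord (m i)].
have mg : mu g = m.
  apply/mnmP => i; rewrite multinomE tnth_mktuple ffunE inordK // ltnS.
  by apply: leq_trans mT; rewrite mdegE (bigD1 i) //= leq_addr.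
have := congr1 (fun B : 'rV_ _ => B 0 (enum_rank g)) vA; rewrite !mxE => e; rewrite -[RHS]e.
by apply: eq_bigr => l _; rewrite mcoeffZ mxE enum_rankK mg.
Qed.

Lemma deg_le_ex m (y : nat -> S) : exists E, forall i, (i < m)%N -> deg_le E (y i).
Proof.
elim: m => [|m [E hE]]; first by exists 0%N.
exists (maxn E (mmeasure mdeg (y m))) => i; rewrite ltnS leq_eqVlt => /orP[/eqP ->|/hE h].
  move=> u; rewrite -mcoeff_msupp => /(@mmeasure_mnm_lt _ _ mdeg) /ltnW h.
  by rewrite leq_max h orbT.
by move=> u /h hu; rewrite leq_max hu.
Qed.

(** With y_i in P (i + 1) but not in P i, there are D^(n + 2) monomials in the y_i with exponents
    below D, all of degree O(D), in spaces of dimension O(D^(n + 1)). For large D they are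
    dependent, against [prime_chain_independent]. *)
Lemma no_long_prime_chain (P : nat -> {pred S}) :
  (forall i, (i <= n.+2)%N -> idealr_closed (P i) /\ prime_idealr_closed (P i)) ->
  (forall i, (i < n.+2)%N -> {subset P i <= P i.+1} /\ ~ {subset P i.+1 <= P i}) -> False.
Proof.
move=> hP hS.
have /choice[y hy] i : exists x : S, (i < n.+2)%N -> x \in P i.+1 /\ x \notin P i.
  have [i2|] := ltnP i n.+2; last by exists 0.
  have [_ /existsNP[x]] := hS i i2; move=> /not_implyP[h1 /negP h2].
  by exists x.
have [E hE] := deg_le_ex n.+2 y.
(* Chosen so that D^(n + 2) exceeds (((n + 2) E + 1) D)^(n + 1). *)
pose D := ((n.+2 * E).+1 ^ n.+1).+1.
pose W := words D n.+2.
have sW : (((n.+2 * (E * D)).+1) ^ n.+1 < size W)%N.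
  rewrite size_words; apply: (@leq_ltn_trans (((n.+2 * E).+1 * D) ^ n.+1)).
    by rewrite leq_exp2r // [leqRHS]mulSn mulnA -add1n leq_add2r.
  by rewrite expnMn [ltnRHS]expnS ltn_pmul2r ?expn_gt0.
have [|c [l cl] c0] := @deg_bounded_dependent _ _ (fun l => ymon y (tnth (in_tuple W) l)) _ sW.
  by move=> l; apply: deg_le_ymon => //; exact: mem_tnth.
pose c' s := if insub (index s W) is Some l then c l else 0.
have c'E l' : c' (tnth (in_tuple W) l') = c l'.
  rewrite /c' (tnth_nth [::]) index_uniq ?uniq_words //.
  by case: insubP => [u _ /val_inj ->|]; rewrite ?ltn_ord.
case/negP: cl; rewrite -c'E; apply/eqP.
apply: (@prime_chain_independent D n.+2 P y c') => //; last exact: mem_tnth.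
  by move=> i hi; have [? ?] := hy i hi; have [? _] := hS i hi; split.
rewrite big_tnth; under eq_bigr do rewrite c'E.
by rewrite c0; have [[]] := hP 0%N (leq0n _).
Qed.

Lemma dim_lt_annihilator (M : gradedModule k n) (f : S) :
  f != 0 -> annihilator M f -> dim_lt M n.+1.
Proof.
move=> f0 fM [P [hP hS]].
(* The zero ideal is put in front of the chain; the first inclusion is strict because f is
   nonzero. *)
pose Q i : {pred S} := if i is j.+1 then P (inord j) else pred1 0.
apply: (@no_long_prime_chain Q) => [[|i] hi|[|i] hi] /=.
- split; last by move=> u v; rewrite !inE mulf_eq0.
  split; rewrite ?inE ?eqxx ?oner_eq0 // => u v w; rewrite !inE => /eqP -> /eqP ->.
  by rewrite mulr0 addr0.
- by have [] := hP (inord i).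
- have [[h0 _ _] _ hf] := hP (inord 0); split.
    by move=> x; rewrite inE => /eqP ->.
  by move=> /(_ f (hf f fM)); rewrite inE (negPf f0).
- by apply: hS; rewrite !inordK // ltnW.
Qed.

End Krull.

Lemma monomial_module_exists (k : fieldType) (n r : nat) (B : 'I_r -> downset n) u :
  (forall i, ~~ B i u) -> exists M : gradedModule k n,
  [/\ finitely_generated M, generated_in_degree_zero M, dim_lt M n.+1 &
      hilbert_function M (fun j => \sum_i (count (B i) (mons n.+1 j))%:R)].
Proof.
move=> hu; exists (mongraded k B); split.
- exact: mongraded_fg.
- exact: mongraded_gen0.
- apply: (@dim_lt_annihilator _ _ _ (mpolyX k u)); last exact: mongraded_annihilator.
  by rewrite -msupp_eq0 msuppX.
- exact: mongraded_hilbert.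
Qed.

(** * Membership in V_{n,a} through tail polynomials *)

Definition in_tail (n : nat) (a : int) (h : nat -> rat) := exists q, tail_poly n a (ext0 h) q.

Lemma in_tailD n a x (h g : nat -> rat) : in_tail n a h -> in_tail n a g ->
  in_tail n a (fun j => x * h j + g j).
Proof.
move=> [p [hp1 hp2]] [q [hq1 hq2]]; exists (x *: p + q); split.
  rewrite (leq_trans (size_polyD _ _)) // geq_max hq1 andbT.
  exact: leq_trans (size_scale_leq _ _) hp1.
move=> j aj; rewrite hornerD hornerZ hp2 // hq2 //.
by case: j aj => //= j _; rewrite mulr0 addr0.
Qed.

Lemma in_tail0 n a : in_tail n a (fun=> 0).
Proof. by exists 0; split=> [|[j|j] _]; rewrite ?size_poly0 ?horner0. Qed.

Lemma in_tail_sum n a r (x : 'I_r -> rat) (h : 'I_r -> nat -> rat) :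
  (forall l, in_tail n a (h l)) -> in_tail n a (fun j => \sum_l x l * h l j).
Proof.
elim: r x h => [|r IH] x h hh.
  have -> : (fun j => \sum_l x l * h l j) = fun=> 0.
    by apply/funext => j; rewrite big_ord0.
  exact: in_tail0.
have -> : (fun j => \sum_l x l * h l j) = fun j => x ord0 * h ord0 j +
    \sum_l x (lift ord0 l) * h (lift ord0 l) j.
  by apply/funext => j; rewrite big_ord_recl.
by apply: in_tailD => //; apply: (IH (fun l => x (lift ord0 l)) (fun l => h (lift ord0 l))).
Qed.

Lemma in_tailW n (a a' : int) h : a <= a' -> in_tail n a h -> in_tail n a' h.
Proof. by move=> aa' [q [h1 h2]]; exists q; split=> // j /(le_lt_trans aa'); exact: h2. Qed.

(** The numerator coefficients are the n-th backward differences, which must vanish beyond a + n; as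
    a + n >= 0, the indices concerned are natural numbers. *)
Lemma VspaceP n (a : int) (h : sequence) : - n%:Z <= a -> Vspace n a h <-> in_tail n a h.
Proof.
move=> han; rewrite /in_tail -iter_bdiff_poly; split=> [[b hb hj] j aj|hj].
  case: j aj => [j|j] aj; last by lia.
  rewrite -iter_bdiff_coef (hj j) nth_default // -lez_nat; apply: le_trans hb _; lia.
pose L := absz (a + n%:Z + 1)%R; have LE : L%:Z = a + n%:Z + 1 by rewrite /L; lia.
exists (\poly_(i < L) iter n bdiff (ext0 h) i%:Z); first by rewrite -LE lez_nat size_poly.
move=> j; rewrite iter_bdiff_coef coef_poly; case: ltnP => // jn.
by apply: hj; lia.
Qed.

Lemma TstepD n x (h g : nat -> rat) j :
  Tstep n (fun j => x * h j + g j) j = x * Tstep n h j + Tstep n g j.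
Proof. by rewrite /Tstep; ring. Qed.

Lemma Tstep_sum n r (x : 'I_r -> rat) (h : 'I_r -> nat -> rat) j :
  Tstep n (fun j => \sum_l x l * h l j) j = \sum_l x l * Tstep n (h l) j.
Proof.
rewrite /Tstep !mulr_sumr -sumrB; apply: eq_bigr => l _; ring.
Qed.

Lemma Tstep_in_tail n a h : in_tail n a h -> in_tail n a (Tstep n h).
Proof. by move=> [q]; exact: Tstep_tail. Qed.

Lemma Tstep_eq n a h g : in_tail n a h -> in_tail n a g ->
  (forall j, Tstep n h j = Tstep n g j) -> h = g.
Proof.
move=> hh hg e; have [q hq] := in_tailD (-1) hg hh.
apply/funext => j; apply/eqP; rewrite -subr_eq0; apply/eqP.
rewrite addrC -mulN1r; apply: (Tstep_inj hq) => i.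
by rewrite TstepD e mulN1r addNr.
Qed.

(** * Nonnegative combinations of Hilbert functions of monomial quotients *)

(** Nonnegative rational combinations with denominators cleared: N h is a sum, with repetitions, of
    Hilbert functions, hence that of a direct sum. The condition y.1 > 0 excludes the zero ideal. *)
Definition Hcone n (h : nat -> rat) := exists N (s : seq (nat * nat)),
  [/\ (0 < N)%N, all (fun y => 0 < y.1)%N s &
      forall j, N%:R * h j = \sum_(y <- s) hbelow n y.1 y.2 j].

Lemma Hcone0 n : Hcone n (fun=> 0).
Proof. by exists 1%N, [::]; split=> // j; rewrite big_nil mulr0. Qed.

Lemma sum_flatten_nseq (T : Type) (N : nat) (s : seq T) (F : T -> rat) :
  \sum_(y <- flatten (nseq N s)) F y = N%:R * \sum_(y <- s) F y.
Proof.
elim: N => [|N IH]; first by rewrite big_nil mul0r.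
by rewrite /= big_cat IH /= -natr1 mulrDl mul1r addrC.
Qed.

Lemma all_flatten_nseq (T : Type) (N : nat) (s : seq T) (P : pred T) :
  all P s -> all P (flatten (nseq N s)).
Proof. by move=> h; elim: N => //= N IH; rewrite all_cat h. Qed.

Lemma HconeD n h g : Hcone n h -> Hcone n g -> Hcone n (fun j => h j + g j).
Proof.
move=> [N [s [N0 s1 hs]]] [M [t [M0 t1 ht]]].
exists (N * M)%N, (flatten (nseq M s) ++ flatten (nseq N t)); split=> [||j].
- by rewrite muln_gt0 N0.
- by rewrite all_cat !all_flatten_nseq.
by rewrite big_cat !sum_flatten_nseq /= -hs -ht natrM; ring.
Qed.

Lemma HconeZ n x h : 0 <= x -> Hcone n h -> Hcone n (fun j => x * h j).
Proof.
move=> x0 [N [s [N0 s1 hs]]].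
exists (N * `|denq x|)%N, (flatten (nseq `|numq x|%N s)); split=> [||j].
- by rewrite muln_gt0 N0 absz_gt0 denq_eq0.
- by rewrite all_flatten_nseq.
rewrite sum_flatten_nseq -hs natrM.
have -> : (`|numq x|%N)%:R = x * (`|denq x|%N)%:R :> rat.
  rewrite !natr_absz !ger0_norm ?numq_ge0 ?denq_ge0 //.
  by rewrite numqE.
by ring.
Qed.

Lemma Hcone_hbelow n c i : (0 < c)%N -> Hcone n (hbelow n c i).
Proof.
by move=> c0; exists 1%N, [:: (c, i)]; rewrite /= c0; split=> // j; rewrite big_seq1 mul1r.
Qed.

Lemma Hcone_sum n r (x : 'I_r -> rat) (h : 'I_r -> nat -> rat) :
  (forall l, 0 <= x l) -> (forall l, Hcone n (h l)) ->
  Hcone n (fun j => \sum_l x l * h l j).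
Proof.
elim: r x h => [|r IH] x h x0 hh.
  have -> : (fun j => \sum_l x l * h l j) = fun=> 0.
    by apply/funext => j; rewrite big_ord0.
  exact: Hcone0.
have -> : (fun j => \sum_l x l * h l j) = fun j => x ord0 * h ord0 j +
    \sum_l x (lift ord0 l) * h (lift ord0 l) j.
  by apply/funext => j; rewrite big_ord_recl.
apply: HconeD; first exact: HconeZ.
by apply: (IH (fun l => x (lift ord0 l)) (fun l => h (lift ord0 l))).
Qed.

Lemma Hcone_ge0 n h : Hcone n h -> forall j, 0 <= h j.
Proof.
move=> [N [s [N0 _ hs]]] j.
rewrite -(pmulr_rge0 _ (_ : 0 < N%:R)) ?ltr0n // hs.
by apply: sumr_ge0 => y _; exact: ler0n.
Qed.

(* For N large, T h is a nonnegative combination of the t^i with i < N and of the T-images of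
   S / (x_0, ..., x_(c-1))^(N+1), which vanish below N and are multiples of
   rising N (n - c) from N on. *)
Lemma Hcone_decomposition n a h : in_tail n a h -> (forall j, 0 <= Tstep n h j) -> Hcone n h.
Proof.
move=> hh T0; have [q hq] := Tstep_in_tail hh.
have lq := tail_poly_ge0 hq T0; have [sq hqj] := hq.
have [N0 hN0] := rising_expansion_ge0 sq lq.
(* Large enough for nonnegative coefficients in the basis [rising N], and beyond a, so that T h is
   polynomial from N on. *)
pose N := maxn N0 `|a|.+1.
have [b b0 eb] := hN0 N (leq_maxl _ _).
have aN : a < N%:Z by have := leq_maxr N0 `|a|.+1; rewrite -/N; lia.
(* With n - d of the n.+1 variables in the ideal, the layer N is a multiple of [rising N d]. *)
pose c (d : 'I_n) := (n - d)%N.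
have cE (d : 'I_n) : (n.+1 - c d).-1 = d by have := ltn_ord d; rewrite /c; lia.
have c0 (d : 'I_n) : (0 < c d)%N by rewrite subn_gt0.
have cn (d : 'I_n) : (c d <= n)%N by exact: leq_subr.
have /choice[x hx] (d : 'I_n) : exists x : rat, 0 < x /\
    forall j, (N <= j)%N -> (layer n.+1 (c d) N j)%:R = x * (rising N%:R d).[j%:R].
  have [|x x0 h1] := @layer_rising n.+1 (c d) N; first exact: cn.
  rewrite cE in h1; exists x; split=> //; rewrite lt_neqAle x0 andbT.
  have := layer_gt0 N (c0 d) (ltn0Sn n); rewrite -(ltr0n rat) h1 // lt_neqAle eq_sym mulf_eq0.
  by rewrite negb_or eq_sym => /andP[/andP[]].
have l0 i : (0 < layer n.+1 n.+1 i i)%N by exact: layer_gt0.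
pose y (d : 'I_n) : rat := b d / (x d * (N + c d)%:R).
pose z (i : 'I_N) : rat := Tstep n h i / ((i + n.+1) * layer n.+1 n.+1 i i)%:R.
pose g1 j := \sum_d y d * hbelow n (c d) N.+1 j.
pose g2 j := \sum_(i < N) z i * hbelow n n.+1 i.+1 j.
have Nc (d : 'I_n) : 0 < (N + c d)%:R :> rat by rewrite ltr0n addn_gt0 c0 orbT.
have eh : h = fun j => g1 j + g2 j.
  have e1 : (fun j => g1 j + g2 j) = (fun j => 1 * g1 j + g2 j).
    by apply/funext => j; rewrite mul1r.
  (* Both sides lie in V_{n,N}, where T is injective, so it suffices to compare T-images. *)
  rewrite e1; apply: (@Tstep_eq n N%:Z); first exact: in_tailW (ltW aN) hh.
    apply: in_tailD; apply: in_tail_sum => l; apply: tail_hbelow.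
    - by rewrite c0 (leq_trans (cn l)).
    - by lia.
    - by rewrite /= leqnn.
    - by have := ltn_ord l; lia.
  move=> j; rewrite TstepD mul1r !Tstep_sum.
  have -> : \sum_(l < N) z l * Tstep n (hbelow n n.+1 l.+1) j =
      if (j < N)%N then Tstep n h j else 0.
    case: ltnP => jN.
      rewrite (bigD1 (Ordinal jN)) //= big1 ?addr0 => [|l lj].
        by rewrite Tstep_hbelow // /z divfK // pnatr_eq0 muln_eq0 addnS /= -lt0n l0.
      rewrite Tstep_hbelow // (_ : layer _ _ _ _ = 0%N) ?muln0 ?mulr0 //.
      apply/eqP; rewrite -leqn0 leqNgt -has_count; apply/hasPn => m.
      by rewrite mem_mons wt_full => /eqP ->; rewrite eq_sym.
    apply: big1 => l _; rewrite Tstep_hbelow // (_ : layer _ _ _ _ = 0%N) ?muln0 ?mulr0 //.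
    apply/eqP; rewrite -leqn0 leqNgt -has_count; apply/hasPn => m.
    by rewrite mem_mons wt_full => /eqP ->; rewrite gtn_eqF // (leq_trans (ltn_ord l)).
  have eT d : Tstep n (hbelow n (c d) N.+1) j = ((N + c d) * layer n.+1 (c d) N j)%:R.
    by rewrite Tstep_hbelow // (leq_trans (cn d)).
  under eq_bigr do rewrite eT.
  case: ltnP => jN.
    by rewrite big1 ?add0r // => d _; rewrite layer_lt // muln0 mulr0.
  rewrite addr0 -[LHS]/(ext0 (Tstep n h) j%:Z).
  rewrite -hqj; last by lia.
  rewrite eb horner_rising_sum; apply: eq_bigr => d _.
  have [x0 hxd] := hx d; rewrite natrM hxd // /y.
  have w0 := Nc d.
  by field; rewrite -natrD !gt_eqF.
rewrite eh; apply: HconeD; apply: Hcone_sum => l.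
- by have [x0 _] := hx l; rewrite divr_ge0 // ltW // mulr_gt0.
- exact: Hcone_hbelow.
- by rewrite divr_ge0.
- exact: Hcone_hbelow.
Qed.

Lemma sum_hbelow_module (k : fieldType) n (s : seq (nat * nat)) :
  all (fun y => 0 < y.1)%N s -> exists M : gradedModule k n,
  [/\ finitely_generated M, generated_in_degree_zero M, dim_lt M n.+1 &
      hilbert_function M (fun j => \sum_(y <- s) hbelow n y.1 y.2 j)].
Proof.
move=> /allP s0; pose t := in_tuple s.
pose B l := belowset n (tnth t l).1 (tnth t l).2.
pose L := (\max_l (tnth t l).2)%N.
(* Since x_0 is among the first c variables for every c > 0, the power x_0^L lies in all the ideals
   and annihilates the module. *)
have wtL c : (0 < c)%N -> wt c (mnm_muln (mnm1 (ord0 : 'I_n.+1)) L) = L.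
  move=> c0; elim: L => [|i IH]; first by rewrite mulm0n /wt big1 // => v _; rewrite mnm0E.
  by rewrite mulmS wtD wt1 c0 IH.
have [|M hM] := @monomial_module_exists k n _ B (mnm_muln (mnm1 ord0) L).
  move=> l; rewrite /B /= /below wtL; last exact/s0/mem_tnth.
  by rewrite -leqNgt (leq_bigmax l).
exists M; suff -> : (fun j => \sum_(y <- s) hbelow n y.1 y.2 j) =
    (fun j => \sum_l (count (B l) (mons n.+1 j))%:R) by [].
by apply/funext => j; rewrite big_tnth.
Qed.

(** * Identification of Q_{n,a} with the cone T h >= 0 *)

Definition Tcone n a : set sequence := [set h | Vspace n a h /\ forall j, 0 <= Tstep n h j].

Lemma eval_continuous (j : nat) : continuous (fun h : sequence => h j).
Proof. exact: proj_continuous. Qed.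

Lemma iter_bdiff_continuous n (j : int) :
  continuous (fun h : sequence => iter n bdiff (ext0 h) j : rat^o).
Proof.
elim: n j => [|n IH] j /=.
  case: j => [j|j]; first exact: (@eval_continuous j).
  exact: (@cst_continuous sequence rat^o 0).
move=> h; have := @cvgB _ _ _ (nbhs h) _ _ _ _ _ (IH j h) (IH (j - 1) h).
exact.
Qed.

Lemma Tstep_continuous n (j : nat) : continuous (fun h : sequence => Tstep n h j : rat^o).
Proof.
have e i (c : rat) : continuous (fun h : sequence => c * h i : rat^o).
  move=> h; have := @cvgMl_tmp _ _ (nbhs h) _ (fun h : sequence => h i : rat^o) c _
    (@eval_continuous i h).
  exact.
move=> h; have := @cvgB _ _ _ (nbhs h) _ _ _ _ _ (e j (n%:R + j%:R + 1) h) (e j.+1 (j%:R + 1) h).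
exact.
Qed.

(** Vanishing of differences and nonnegativity of T h are closed conditions, each on finitely many
    coordinates. *)
Lemma Tcone_closed n a : - n%:Z <= a -> closed (Tcone n a).
Proof.
move=> han.
have -> : Tcone n a = \bigcap_(j in [set j : int | a + n%:Z < j])
      ((fun h : sequence => iter n bdiff (ext0 h) j : rat^o) @^-1` [set x | x = 0])
    `&` \bigcap_j ((fun h : sequence => Tstep n h j : rat^o) @^-1` [set x | 0 <= x]).
  apply/seteqP; split=> h /=.
    rewrite /Tcone /= VspaceP // => -[/iter_bdiff_poly h1 h2].
    by split=> [j hj|j _]; [exact: h1 | exact: h2].
  move=> [h1 h2]; rewrite /Tcone /= VspaceP //; split=> [|j]; last exact: h2.
  by apply/iter_bdiff_poly => j hj; exact: h1.
apply: closedI; apply: closed_bigI => j _; apply: preimage_closed.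
- by move=> h _; exact: iter_bdiff_continuous.
- exact: closed_eq.
- by move=> h _; exact: Tstep_continuous.
- exact: closed_ge.
Qed.

Lemma Tcone_combination n a (x y : rat) (h g : sequence) : - n%:Z <= a -> 0 <= x -> 0 <= y ->
  Tcone n a h -> Tcone n a g -> Tcone n a (x *: h + y *: g).
Proof.
move=> han x0 y0 [/(VspaceP h han) h1 h2] [/(VspaceP g han) g1 g2]; split.
  apply/VspaceP => //; apply: (@in_tailD n a x h (y *: g)) => //.
  have -> : (y *: g : nat -> rat) = (fun j => y * g j + 0).
    by apply/funext => j; rewrite addr0.
  by apply: (@in_tailD n a y g (fun=> 0)) => //; exact: in_tail0.
move=> j; have -> : Tstep n (x *: h + y *: g) j = x * Tstep n h j + y * Tstep n g j.
  rewrite /Tstep.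
  have e i : (x *: h + y *: g) i = x * h i + y * g i by [].
  by rewrite !e; ring.
by rewrite addr_ge0 // mulr_ge0.
Qed.

Lemma Tcone_convex n a : - n%:Z <= a ->
  convex_set (M := prod_topology (fun _ : nat => rat^o)) (Tcone n a).
Proof.
move=> han x y l /set_mem hx /set_mem hy; apply/mem_set.
apply: Tcone_combination => //; first exact: interval_inference.ge0.
by rewrite /unstable.onem subr_ge0; exact: interval_inference.le1.
Qed.

Lemma module_in_Tcone (k : fieldType) n a :
  module_hilbert_functions k n a `<=` Tcone n a.
Proof.
move=> h [hV [M [_ hM _ hh]]]; split=> //; exact: hilbert_Tstep_ge0 hM hh.
Qed.

Lemma Tcone_scaled_module (k : fieldType) n a h : - n%:Z <= a -> Tcone n a h ->
  exists2 N : nat, (0 < N)%N & module_hilbert_functions k n a (N%:R *: h).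
Proof.
move=> han hT; have [hV h0] := hT.
have [N [s [N0 s0 hs]]] := Hcone_decomposition (proj1 (VspaceP h han) hV) h0.
exists N => //; split.
  have [] := Tcone_combination han (ler0n _ N) (lexx 0) hT hT.
  by rewrite scale0r addr0.
have [M [h1 h2 h3 h4]] := sum_hbelow_module k n s0; exists M; split=> //.
suff -> : (N%:R *: h : nat -> rat) = (fun j => \sum_(y <- s) hbelow n y.1 y.2 j) by [].
by apply/funext => j; rewrite -hs.
Qed.

Lemma Tcone_zero n a : - n%:Z <= a -> Tcone n a 0.
Proof.
move=> han; split; first by apply/VspaceP => //; exact: in_tail0.
by move=> j; rewrite /Tstep !mulr0 subr0.
Qed.

Lemma zero_module (k : fieldType) n a : - n%:Z <= a -> module_hilbert_functions k n a 0.
Proof.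
move=> han; have [N _] := Tcone_scaled_module k han (Tcone_zero han).
by rewrite scaler0.
Qed.

(** The cone is closed, convex and contains the Hilbert functions. Conversely h is the convex
    combination of N h and 0, with weights 1/N and 1 - 1/N, both of them Hilbert functions. *)
Lemma QconeE (k : fieldType) n a : - n%:Z <= a -> Qcone k n a = Tcone n a.
Proof.
move=> han; apply/seteqP; split=> h.
  apply; split; last exact: module_in_Tcone.
  by split; [move=> g [] | exact: Tcone_closed | exact: Tcone_convex].
move=> hT A [[_ _ Ac] AM].
have [N N0 hN] := Tcone_scaled_module k han hT.
have i0 : 0 <= N%:R^-1 :> rat by rewrite invr_ge0 ler0n.
have i1 : N%:R^-1 <= 1 :> rat by rewrite invf_le1 ?ltr0n // ler1n.
have := Ac _ _ (interval_inference.Itv01 i0 i1) (mem_set (AM _ hN))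
  (mem_set (AM _ (zero_module k han))).
move=> /set_mem; rewrite /conv /= /unstable.onem.
by rewrite scaler0 addr0 scalerA mulVf ?scale1r // pnatr_eq0 -lt0n.
Qed.

Lemma TconeE n a : - n%:Z <= a ->
  Tcone n a = (\bigcap_j halfspace n a j) `&` limiting_halfspace n a.
Proof.
move=> han; apply/seteqP; split=> [h [hV hT]|h [h1 [hV _]]]; last first.
  by split=> // j; have [_] := h1 j I; rewrite /Tstep subr_ge0.
split; first by move=> j _; split=> //; have := hT j; rewrite /Tstep subr_ge0.
split=> //; have hh := proj1 (VspaceP h han) hV; have [q hq] := hh; exists q.
  by move=> j aj; have [_ /(_ j aj)] := hq.
have l0 := tail_poly_ge0 hq (Hcone_ge0 (Hcone_decomposition hh hT)).
(* Either the tail polynomial has degree n - 1 and its leading coefficient is the one tested, or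
   that coefficient is 0. *)
have [sq _] := hq; move: sq l0; rewrite leq_eqVlt => /orP[/eqP <- //|sq] _.
by rewrite nth_default //; case: n sq {hq han h hV hT hh}.
Qed.

(** * Extreme rays *)

Definition Wcone n a : set sequence := [set g | in_tail n a g /\ forall j, 0 <= g j].

(** Extremality through decompositions of the generator alone, a form that is easily transported
    along T. *)
Definition extremal (C : set sequence) (g : sequence) :=
  [/\ C g, g != 0 & forall u v, C u -> C v -> u + v = g -> exists2 c : rat, 0 <= c & u = c *: g].

Lemma Top_inj n a (h g : sequence) : in_tail n a h -> in_tail n a g ->
  Top n h = Top n g -> h = g.
Proof. by move=> hh hg e; apply: (@Tstep_eq n a) => // j; exact: (congr1 (@^~ j) e). Qed.

Lemma TopD n (x : rat) (h g : sequence) : Top n (x *: h + g) = x *: Top n h + Top n g.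
Proof. by apply/funext => j; exact: TstepD. Qed.

Lemma Top_surj n a (g : sequence) : - n%:Z <= a -> in_tail n a g ->
  exists2 h : sequence, in_tail n a h & Top n h = g.
Proof.
move=> han [q hq]; have [h [h1 h2]] := Tstep_surj han hq.
by exists h => //; apply/funext => j; exact: h2.
Qed.

Lemma in_tailZ n a (x : rat) (h : sequence) : in_tail n a h -> in_tail n a (x *: h).
Proof.
move=> hh; have -> : (x *: h : nat -> rat) = (fun j => x * h j + 0).
  by apply/funext => j; rewrite addr0.
exact: in_tailD hh (in_tail0 n a).
Qed.

Lemma in_tail_add n a (h g : sequence) : in_tail n a h -> in_tail n a g -> in_tail n a (h + g).
Proof.
move=> hh hg; have -> : (h + g : nat -> rat) = (fun j => 1 * h j + g j).
  by apply/funext => j; rewrite mul1r.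
exact: in_tailD.
Qed.

Lemma TopZ n (x : rat) (h : sequence) : Top n (x *: h) = x *: Top n h.
Proof. by apply/funext => j; rewrite /Top /=; rewrite !scalrfctE /GRing.scale /=; ring. Qed.

Lemma Top0 n : Top n 0 = 0.
Proof. by apply/funext => j; rewrite /Top !mulr0 subr0. Qed.

Lemma Top_add n (h g : sequence) : Top n (h + g) = Top n h + Top n g.
Proof. by have := TopD n 1 h g; rewrite !scale1r. Qed.

(** T is a linear bijection from [Tcone n a] onto [Wcone n a]. *)
Lemma extremal_Top n a (h : sequence) : - n%:Z <= a -> in_tail n a h ->
  extremal (Tcone n a) h <-> extremal (Wcone n a) (Top n h).
Proof.
move=> han hh; have TW g : Tcone n a g <-> in_tail n a g /\ Wcone n a (Top n g).
  split=> [[/VspaceP g1 g2]|[g1 [_ g2]]]; last by split=> //; apply/VspaceP.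
  by split; [exact: g1 | split=> //; exact/Tstep_in_tail/g1].
have nz : h != 0 <-> Top n h != 0.
  split; apply: contra_neq => e; last by rewrite e Top0.
  by apply: (@Top_inj n a) => //; [exact: in_tail0 | rewrite Top0].
split=> [[/TW[_ h1] /nz h2 h3]|[h1 /nz h2 h3]].
  split=> // u v hu hv e.
  have [u' u1 u2] := Top_surj han (proj1 hu); have [v' v1 v2] := Top_surj han (proj1 hv).
  have [|||c c0 ec] := h3 u' v'.
  - by apply/TW; rewrite u2.
  - by apply/TW; rewrite v2.
  - apply: (@Top_inj n a) => //; first exact: in_tail_add.
    by rewrite Top_add u2 v2.
  by exists c => //; rewrite -u2 ec TopZ.
split=> //; first by apply/TW.
move=> u v /TW[u1 u2] /TW[v1 v2] e.
have [//|//||c c0 ec] := h3 (Top n u) (Top n v); first by rewrite -Top_add e.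
exists c => //; apply: (@Top_inj n a) => //; first exact: in_tailZ.
by rewrite TopZ.
Qed.

Lemma Tcone_ge0 n a (h : sequence) : - n%:Z <= a -> Tcone n a h -> forall j, 0 <= h j.
Proof.
by move=> han [/(VspaceP h han) h1 h2]; exact: Hcone_ge0 (Hcone_decomposition h1 h2).
Qed.

Lemma Tcone_scale n a (x : rat) h : - n%:Z <= a -> 0 <= x -> Tcone n a h -> Tcone n a (x *: h).
Proof.
move=> han x0 hT; have := Tcone_combination han x0 (lexx 0) hT hT.
by rewrite scale0r addr0.
Qed.

Lemma extreme_rayP n a R : - n%:Z <= a ->
  extreme_ray (Tcone n a) R <-> exists2 g, extremal (Tcone n a) g & R = ray g.
Proof.
move=> han; split=> [[[g [g1 g2 ->]] h]|[g [g1 g2 g3] ->]].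
  exists g => //; split=> // u v hu hv e.
  have [|[c c0 ->] _] := h u v hu hv; last by exists c.
  by rewrite e; exists 1; rewrite ?scale1r.
split; first by exists g.
have half u v : Tcone n a u -> Tcone n a v -> ray g (u + v) -> ray g u.
  (* For c = 0 nonnegativity forces u = v = 0; otherwise division by c gives a decomposition of
     g. *)
  move=> hu hv [c c0 e]; have [c00|cn0] := eqVneq c 0.
    exists 0 => //; rewrite scale0r; apply/funext => j.
    have := congr1 (@^~ j) e; rewrite c00 scale0r => ej.
    have : u j + v j = 0 by exact: ej.
    move/eqP; rewrite paddr_eq0 ?(Tcone_ge0 han hu) ?(Tcone_ge0 han hv) //.
    by move=> /andP[/eqP].
  have ic : 0 <= c^-1 by rewrite invr_ge0.
  have [|||d d0 ed] := g3 (c^-1 *: u) (c^-1 *: v); try exact: Tcone_scale.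
    by rewrite -scalerDr e scalerA mulVf // scale1r.
  exists (c * d); first exact: mulr_ge0.
  by rewrite -scalerA -ed scalerA mulfV // scale1r.
move=> u v hu hv e; split; first exact: half hv e.
by apply: half hv hu _; rewrite addrC.
Qed.

Lemma ray_scale (c : rat) g : 0 < c -> ray (c *: g) = ray g.
Proof.
move=> c0; apply/seteqP; split=> h [d d0 ->].
  by exists (d * c); rewrite ?scalerA // mulr_ge0 // ltW.
by exists (d / c); rewrite ?divr_ge0 ?(ltW c0) // scalerA divfK // gt_eqF.
Qed.

Lemma lead_coefD_ge0 (p q : {poly rat}) : 0 <= lead_coef p -> 0 <= lead_coef q ->
  (size p <= size (p + q)%R)%N.
Proof.
move=> hp hq; have [->|p0] := eqVneq p 0; first by rewrite size_poly0.
have [spq|spq|spq] := ltngtP (size p) (size q).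
- by rewrite addrC size_polyDl // ltnW.
- by rewrite size_polyDl.
have sp : size p = (size p).-1.+1 by rewrite prednK // size_poly_gt0.
rewrite [leqLHS]sp ltnNge; apply/negP => /leq_sizeP/(_ _ (leqnn _)).
rewrite coefD {2}spq -!lead_coefE => /eqP; rewrite paddr_eq0 //.
by rewrite lead_coef_eq0 (negPf p0).
Qed.

Lemma ext0D (h g : sequence) j : ext0 (h + g) j = ext0 h j + ext0 g j.
Proof. by case: j => [j|j] //=; rewrite addr0. Qed.

(* In a decomposition g = u + v, the tail polynomial of u has degree at most that of g and
   vanishes at all the roots of the latter. *)
Lemma extremal_roots n a (g : sequence) c0 (rs : seq int) : Wcone n a g ->
  (forall j : nat, j%:Z <= a -> g j = 0) -> uniq rs -> all (fun z => a < z) rs -> c0 != 0 ->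
  tail_poly n a (ext0 g) (c0 *: \prod_(z <- rs) ('X - (z%:~R)%:P)) -> extremal (Wcone n a) g.
Proof.
set q := c0 *: _ => gW g0 urs /allP ars c00 hq.
have sq : size q = (size rs).+1 by rewrite size_scale // size_prod_XsubC.
have lq0 : 0 <= lead_coef q by exact: tail_poly_ge0 hq (proj2 gW).
have qn0 : q != 0 by rewrite -size_poly_eq0 sq.
have lq : 0 < lead_coef q by rewrite lt_neqAle eq_sym lead_coef_eq0 qn0.
split=> //.
  apply: contra_neq qn0 => gz; apply: (tail_poly_uniq hq); split; first by rewrite size_poly0.
  by move=> [j|j] _; rewrite horner0 gz.
move=> u v [[qu hu] u0] [[qv hv] v0] e.
have uv (j : nat) : u j + v j = g j by rewrite -e.
have quv : qu + qv = q.
  apply: (@tail_poly_uniq n a (ext0 g)) hq; split.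
    by rewrite (leq_trans (size_polyD _ _)) // geq_max (proj1 hu) (proj1 hv).
  by move=> j aj; rewrite hornerD (proj2 hu) // (proj2 hv) // -ext0D e.
have lu := tail_poly_ge0 hu u0; have lv := tail_poly_ge0 hv v0.
have squ : (size qu <= (size rs).+1)%N by rewrite -sq -quv lead_coefD_ge0.
have ru : all (root qu) [seq z%:~R : rat | z <- rs].
  apply/allP => _ /mapP[z zrs ->]; have az := ars z zrs; rewrite rootE (proj2 hu) //.
  case: z zrs az => [j|j] zrs az //=.
  have gj : g j = 0.
    have := proj2 hq j%:Z az; rewrite /= => <-.
    rewrite hornerZ horner_prod (big_rem j%:Z) //= hornerXsubC subrr mul0r mulr0 //.
  have /eqP := uv j; rewrite gj paddr_eq0 //.
  by case/andP.
have uqu : uniq_roots [seq z%:~R : rat | z <- rs].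
  by rewrite uniq_rootsE map_inj_uniq //; exact: intr_inj.
have [x ex] : exists x : rat, qu = x *: q.
  (* A polynomial vanishing at all of rs, of degree at most their number, is a multiple of q, and is
     zero if the degree is smaller. *)
  move: squ; rewrite leq_eqVlt => /orP[/eqP squ|squ].
    exists (lead_coef qu / c0); rewrite /q scalerA divfK //.
    rewrite {1}(@all_roots_prod_XsubC _ qu [seq z%:~R : rat | z <- rs]) //.
      by rewrite big_map.
    by rewrite squ size_map.
  exists 0; rewrite scale0r; apply/eqP/negPn/negP => qu0.
  have := max_poly_roots qu0 ru _; rewrite uniq_rootsE in uqu.
  by rewrite size_map ltnNge -ltnS squ => /(_ uqu).
exists x; first by have := lu; rewrite ex lead_coefZ pmulr_lge0.
apply/funext => j; rewrite scalrfctE; have [ja|aj] := lerP j%:Z a.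
  have /eqP := uv j; rewrite g0 // paddr_eq0 // => /andP[/eqP -> _].
  by rewrite scaler0.
have := proj2 hu j%:Z aj; rewrite /= => <-; rewrite ex hornerZ.
by rewrite (proj2 hq j%:Z aj).
Qed.

(* Adds 2 i to the i-th part of the reversed partition, giving the first elements of the pairs of
   consecutive roots. *)
Fixpoint pair_starts (w : nat) (nu : seq nat) : seq nat :=
  if nu is x :: nu' then (w + x)%N :: pair_starts w.+2 nu' else [::].

Lemma size_pair_starts w nu : size (pair_starts w nu) = size nu.
Proof. by elim: nu w => //= x nu IH w; rewrite IH. Qed.

Lemma spaced_pair_starts w x nu : path leq x nu -> spaced (w + x) (pair_starts w nu).
Proof.
elim: nu w x => //= y nu IH w x /andP[xy hy].
by rewrite leq_add2l xy -!addSn IH.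
Qed.

Lemma pair_starts_surj w x ms : spaced (w + x) ms ->
  exists2 nu, path leq x nu & ms = pair_starts w nu.
Proof.
elim: ms w x => [|m ms IH] w x; first by exists [::].
move=> /= /andP[wm hm]; have wm' : (w <= m)%N by apply: leq_trans wm; exact: leq_addr.
have [|nu h1 h2] := IH w.+2 (m - w)%N; first by rewrite !addSn subnKC.
exists ((m - w)%N :: nu); last by rewrite /= subnKC // h2.
by rewrite /= h1 andbT leq_subRL.
Qed.

Lemma prod_pair_starts (R : comNzRingType) w nu (F : nat -> R) :
  \prod_(z <- pairs (pair_starts w nu)) F z =
  \prod_(i < size nu) (F (w + nth 0 nu i + 2 * i)%N * F (w + nth 0 nu i + 2 * i).+1%N).
Proof.
elim: nu w => [|x nu IH] w; first by rewrite big_nil big_ord0.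
rewrite /pairs /= !big_cons -/(pairs _) IH big_ord_recl /= muln0 addn0 mulrA; congr (_ * _).
apply: eq_bigr => i _; rewrite /bump /= add1n mulnS.
by rewrite !addSn !addnS add0n addnA.
Qed.

(** [p_] reads the parts from the last one, so the pairs of roots come from the reversed partition;
    w translates them. *)
Lemma p_horner la (w : nat) (s : int) :
  (p_ la).[s] = \prod_(z <- pairs (pair_starts w (rev la))) (s + w%:Z - z%:Z).
Proof.
rewrite prod_pair_starts size_rev /p_ horner_prod big_add1 /= big_mkord.
apply: eq_bigr => i _; rewrite hornerM !hornerXsubC nth_rev //.
by congr (_ * _); rewrite ?PoszD; lia.
Qed.

(** * Extremal nonnegative sequences in V_{n,a} *)

Section Series.
Variables (n : nat) (a : int).

(** The least natural number greater than a. *)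
Definition start : nat := absz (ahat a).
(** This is max(1, -a), one more than the number of negative integers above a. *)
Definition gap : nat := absz (ahat a - a).

Lemma ahatE : ahat a = start%:Z.
Proof. by rewrite /start /ahat; lia. Qed.

Lemma gapE : gap%:Z = start%:Z - a.
Proof. by rewrite /gap /start /ahat; lia. Qed.

Lemma gap_gt0 : (0 < gap)%N.
Proof. by rewrite /gap /ahat; lia. Qed.

Lemma start_le (j : nat) : (start <= j)%N = (a < j%:Z).
Proof. by rewrite /start /ahat; apply/idP/idP; lia. Qed.

Lemma start_gap : (1 < gap)%N -> start = 0%N.
Proof. by rewrite /gap /start /ahat; lia. Qed.

Definition neg_roots : seq int := [seq - l%:Z | l <- iota 1 gap.-1].

(* The negative integers > a, where V_{n,a} forces a zero, the pairs and, in the odd case, the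
   integer start.  For a >= 0 there are no negative roots and gap = 1. *)
Definition root_list (b : bool) (ms : seq nat) : seq int :=
  [seq z%:Z | z <- pairs ms] ++ nseq b start%:Z ++ neg_roots.

Definition root_poly b ms : {poly rat} := \prod_(z <- root_list b ms) ('X - (z%:~R)%:P).

Definition root_series b ms : sequence :=
  fun j => if (start <= j)%N then (root_poly b ms).[j%:R] else 0.

Lemma mem_neg_roots (z : int) : (z \in neg_roots) = (a < z < 0).
Proof.
apply/mapP/idP => [[l] |/andP[az z0]].
  have := gapE; have := start_gap; have := gap_gt0.
  by rewrite mem_iota => ? ? ? /andP[h1 h2] ->; lia.
exists (absz z); last by lia.
have := gapE; have := start_gap; have := gap_gt0; rewrite mem_iota /start /ahat; lia.
Qed.

Lemma neg_roots_uniq : uniq neg_roots.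
Proof. by rewrite map_inj_uniq ?iota_uniq // => x y; lia. Qed.

Lemma root_list_gt (b : bool) ms : spaced (start + b) ms -> all (fun z => a < z) (root_list b ms).
Proof.
move=> /spaced_pairs_ge/allP h; rewrite /root_list !all_cat; apply/and3P; split.
- apply/allP => _ /mapP[m /h hm ->]; rewrite -start_le.
  by apply: leq_trans hm; exact: leq_addr.
- by case: b h => //= _; rewrite -start_le leqnn.
- by apply/allP => z; rewrite mem_neg_roots => /andP[].
Qed.

Lemma root_list_uniq (b : bool) ms : spaced (start + b) ms -> uniq (root_list b ms).
Proof.
move=> hms; have /allP h := spaced_pairs_ge hms.
rewrite /root_list !cat_uniq; apply/and5P; split.
- by rewrite map_inj_uniq ?(uniq_pairs hms) // => x y [].
- apply/hasPn => z; rewrite mem_cat => hz; apply/negP => /mapP[m /h hm ez].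
  case/orP: hz; last by rewrite mem_neg_roots ez; lia.
  by rewrite mem_nseq ez; case: b hms h hm => //= _ _ hm; lia.
- by case: b hms h.
- apply/hasPn => z; rewrite mem_neg_roots mem_nseq => hz; apply/negP => /andP[_ /eqP ez].
  by move: hz; rewrite ez; lia.
- exact: neg_roots_uniq.
Qed.

Lemma size_root_poly (b : bool) ms : size (root_poly b ms) = ((size ms).*2 + b + gap)%N.
Proof.
rewrite size_prod_XsubC !size_cat size_map size_pairs size_nseq size_map size_iota.
have := gap_gt0; lia.
Qed.

Lemma root_series_tail (b : bool) ms : spaced (start + b) ms -> ((size ms).*2 + b + gap <= n)%N ->
  tail_poly n a (ext0 (root_series b ms)) (root_poly b ms).
Proof.
move=> hms hs; split; first by rewrite size_root_poly.
move=> [j|j] aj; first by rewrite /= /root_series start_le aj.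
rewrite /root_poly (big_rem (Negz j)) /=; last first.
  by rewrite !mem_cat mem_neg_roots aj !orbT.
by rewrite hornerM hornerXsubC subrr mul0r.
Qed.

Lemma pairs_prod_ge0 ms (j : nat) : 0 <= \prod_(z <- pairs ms) (j%:R - z%:R : rat).
Proof.
rewrite /pairs; elim: ms => [|m ms IH]; first by rewrite big_nil.
rewrite /= !big_cons mulrA mulr_ge0 //; case: (leqP j m) => jm.
  by rewrite mulr_le0 // subr_le0 ler_nat // leqW.
by rewrite mulr_ge0 // subr_ge0 ler_nat // ltnW.
Qed.

Lemma neg_roots_prod_gt0 (j : nat) : 0 < \prod_(z <- neg_roots) (j%:R - z%:~R : rat).
Proof.
rewrite big_map big_seq; apply: prodr_gt0 => l; rewrite mem_iota => /andP[l0 _].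
by rewrite mulrNz opprK -pmulrn -natrD ltr0n addn_gt0 l0 orbT.
Qed.

Lemma root_poly_horner b ms (s : rat) : (root_poly b ms).[s] =
  \prod_(z <- pairs ms) (s - z%:R) * (if b then s - start%:R else 1)
  * \prod_(z <- neg_roots) (s - z%:~R).
Proof.
rewrite /root_poly /root_list horner_prod !big_cat big_map /= mulrA /=; congr (_ * _ * _).
- by apply: eq_bigr => z _; rewrite hornerXsubC.
- by case: b; rewrite /= ?big_seq1 ?hornerXsubC // big_nil.
- by apply: eq_bigr => z _; rewrite hornerXsubC.
Qed.

Lemma root_series_ge0 b ms j : 0 <= root_series b ms j.
Proof.
rewrite /root_series; case: leqP => // aj.
rewrite root_poly_horner !mulr_ge0 ?pairs_prod_ge0 ?(ltW (neg_roots_prod_gt0 j)) //.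
by case: b; rewrite ?subr_ge0 ?ler_nat.
Qed.

Lemma neg_roots_prod (j : nat) :
  \prod_(z <- neg_roots) (j%:R - z%:~R) = (\prod_(1 <= l < gap) (j%:Z + l%:Z))%:~R :> rat.
Proof.
rewrite big_map rmorph_prod /index_iota subn1; apply: eq_bigr => l _ /=.
by rewrite mulrNz opprK intrD.
Qed.

Lemma pairs_prod_int (w : nat) la (j : nat) :
  \prod_(z <- pairs (pair_starts w (rev la))) (j%:R - z%:R) =
  ((p_ la).[j%:Z - w%:Z])%:~R :> rat.
Proof.
rewrite (p_horner la w) subrK rmorph_prod; apply: eq_bigr => z _ /=.
by rewrite intrB.
Qed.

Lemma even_seriesE la : even_series a la = root_series false (pair_starts start (rev la)).
Proof.
apply/funext => j; rewrite /even_series /root_series -/gap ahatE lez_nat; case: leqP => // aj.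
by rewrite root_poly_horner mulr1 pairs_prod_int neg_roots_prod intrM.
Qed.

Lemma odd_seriesE mu : odd_series a mu = root_series true (pair_starts start.+1 (rev mu)).
Proof.
apply/funext => j; rewrite /odd_series /root_series -/gap ahatE lez_nat; case: leqP => // aj.
rewrite root_poly_horner pairs_prod_int neg_roots_prod -mulrA intrM; congr (_%:~R * _).
  by congr (_.[_]); lia.
(* The factor l = 0 is j - start; further factors occur only for gap > 1, and then start = 0. *)
rewrite big_ltn ?gap_gt0 // addr0 intrM intrB; congr (_ * _%:~R).
have [g1|g1] := leqP gap 1; first by rewrite !big_geq.
by apply: eq_bigr => l _; rewrite start_gap // subr0.
Qed.

(** The tail polynomial is unique, so its degree decides membership. *)
Lemma root_series_in_tail (b : bool) ms : spaced (start + b) ms ->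
  in_tail n a (root_series b ms) <-> ((size ms).*2 + b + gap <= n)%N.
Proof.
move=> hms; split=> [[q [sq hq]]|hs]; last by exists (root_poly b ms); exact: root_series_tail.
rewrite -size_root_poly (_ : root_poly b ms = q) //.
apply: (@poly_eventually_eq _ _ _ start) => j aj.
have := hq j%:Z; rewrite -start_le => /(_ aj) /=.
by rewrite /root_series aj.
Qed.

Lemma root_series_extremal (b : bool) ms : spaced (start + b) ms ->
  in_tail n a (root_series b ms) -> extremal (Wcone n a) (root_series b ms).
Proof.
move=> hms ht; apply: (@extremal_roots n a _ 1 (root_list b ms)).
- by split=> //; exact: root_series_ge0.
- by move=> j; rewrite leNgt -start_le /root_series => /negPf ->.
- exact: root_list_uniq.
- exact: root_list_gt.
- exact: oner_neq0.
rewrite scale1r; apply: root_series_tail => //.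
exact/root_series_in_tail.
Qed.

Definition delta (i : nat) : sequence := fun j => (j == i)%:R.

Lemma delta_in_tail i : i%:Z <= a -> in_tail n a (delta i).
Proof.
move=> ia; exists 0; split; first by rewrite size_poly0.
by move=> [j|j] aj; rewrite horner0 //= /delta; case: eqP => // e; lia.
Qed.

Lemma delta_extremal i : i%:Z <= a -> extremal (Wcone n a) (delta i).
Proof.
move=> ia; split.
- by split=> [|j]; [exact: delta_in_tail | exact: ler0n].
- by apply/eqP => e; have := congr1 (@^~ i) e; rewrite /delta eqxx => /eqP; rewrite oner_eq0.
move=> u v [_ u0] [_ v0] e; exists (u i) => //; apply/funext => j.
have uv : u j + v j = delta i j by rewrite -e.
rewrite scalrfctE /delta /GRing.scale /=; case: (j =P i) => [->|/eqP ji]; first by rewrite mulr1.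
move: uv; rewrite /delta (negPf ji) mulr0 => /eqP; rewrite paddr_eq0 //.
by case/andP => /eqP.
Qed.

Lemma Wcone_sub (g u : sequence) : in_tail n a g -> in_tail n a u ->
  (forall j, u j <= g j) -> Wcone n a (g - u).
Proof.
move=> hg hu le; split; last by move=> j; rewrite subr_ge0.
by rewrite addrC -scaleN1r; apply: in_tail_add => //; exact: in_tailZ.
Qed.

(** The decomposition g = u + (g - u) stays in the cone. *)
Lemma extremal_below (g u : sequence) : extremal (Wcone n a) g -> Wcone n a u -> u != 0 ->
  (forall j, u j <= g j) -> exists2 d : rat, 0 < d & g = d *: u.
Proof.
move=> gE uW u0 le; have [gW _ h] := gE.
have [|||c c0 ec] := h u (g - u) => //; first exact: Wcone_sub (proj1 gW) (proj1 uW) le.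
  by rewrite addrC subrK.
have cn0 : c != 0 by apply: contra_neq u0 => c00; rewrite ec c00 scale0r.
exists c^-1; first by rewrite invr_gt0 lt_neqAle eq_sym cn0.
by rewrite ec scalerA mulVf // scale1r.
Qed.

(** In each case g dominates a positive multiple of a candidate: t^i if g i is nonzero for some i <=
    a, otherwise the series whose roots cover those of g. *)
Lemma extremal_classification (g : sequence) : extremal (Wcone n a) g ->
  (exists i : nat, i%:Z <= a /\ exists2 d : rat, 0 < d & g = d *: delta i) \/
  exists (b : bool) ms, [/\ spaced (start + b) ms, ((size ms).*2 + b + gap <= n)%N &
    exists2 d : rat, 0 < d & g = d *: root_series b ms].
Proof.
move=> gE; have [[gt g0] gn0 gdec] := gE.
have [[i [ia gi]]|nex] := pselect (exists i : nat, i%:Z <= a /\ g i != 0).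
  left; exists i; split=> //.
  have gi0 : 0 < g i by rewrite lt_neqAle eq_sym gi g0.
  have [||||d d0 ed] := @extremal_below g (g i *: delta i).
  - exact: gE.
  - split; first exact/in_tailZ/delta_in_tail.
    by move=> j; rewrite mulr_ge0 // ler0n.
  - rewrite scaler_eq0 negb_or gi; apply/eqP => e.
    by have := congr1 (@^~ i) e; rewrite /delta eqxx => /eqP; rewrite oner_eq0.
  - move=> j; rewrite scalrfctE /delta /GRing.scale /=.
    by case: (j =P i) => [->|_]; rewrite ?mulr1 ?mulr0.
  by exists (d * g i); [exact: mulr_gt0 | rewrite -scalerA].
have gz (j : nat) : j%:Z <= a -> g j = 0.
  by move=> ja; apply/eqP/negPn/negP => gj; apply: nex; exists j.
right; have [q hq] := gt; have [sq hqj] := hq.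
have gq (j : nat) : (start <= j)%N -> g j = q.[j%:R].
  by rewrite start_le => aj; rewrite (hqj j%:Z).
have qn0 : q != 0.
  apply: contra_neq gn0 => q0; apply/funext => j.
  case: (leqP start j) => [aj|]; first by rewrite gq // q0 horner0.
  by rewrite ltnNge start_le -leNgt => /gz.
(* The forced negative roots are divided out; their product p0 is positive at natural numbers, so q1
   keeps the signs of q there. *)
have [||q1 eq1] := @uniq_roots_prod_XsubC _ q [seq z%:~R : rat | z <- neg_roots].
- apply/allP => _ /mapP[z hz ->]; move: hz; rewrite mem_neg_roots => /andP[az z0].
  by rewrite rootE hqj //; move: z0; clear; case: z.
- by rewrite uniq_rootsE map_inj_uniq ?neg_roots_uniq //; exact: intr_inj.
rewrite big_map in eq1; set p0 := \prod_(_ <- _) _ in eq1.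
have p0E (j : nat) : 0 < p0.[j%:R].
  rewrite /p0 horner_prod (eq_bigr (fun z => j%:R - z%:~R)) ?neg_roots_prod_gt0 //.
  by move=> z _; rewrite hornerXsubC.
have q1n0 : q1 != 0 by apply: contra_neq qn0 => q10; rewrite eq1 q10 mul0r.
have sp0 : size p0 = gap.
  by rewrite size_prod_XsubC size_map size_iota; have := gap_gt0; lia.
have sq1 : size q = (size q1 + gap).-1.
  by rewrite eq1 size_Mmonic ?monic_prod_XsubC // sp0.
have [j aj|b [ms [h1 h2 h3]]] := @pairs_cover_rat q1 start q1n0.
  by rewrite -(pmulr_lge0 _ (p0E j)) -hornerM -eq1 -gq.
have sr : ((size ms).*2 + b + gap <= size q)%N.
  by rewrite sq1; case: (size q1) h2 => // i; rewrite ltnS addSn /= leq_add2r.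
exists b, ms; split=> //; first exact: leq_trans sr sq.
have ht : in_tail n a (root_series b ms).
  by apply/root_series_in_tail => //; exact: leq_trans sr sq.
have rE (j : nat) : (start <= j)%N -> root_series b ms j = (root_poly b ms).[j%:R].
  by rewrite /root_series => ->.
have [|j aj|j aj rj||//|e e0 he] := @poly_dominate q (root_poly b ms) start.
- by move=> j aj; rewrite -gq.
- by rewrite -rE // root_series_ge0.
- rewrite rootE root_poly_horner.
  rewrite rootE eq1 hornerM mulf_eq0 (gt_eqF (p0E j)) orbF in rj.
  have /orP[/andP[bt /eqP ->]|hj] := h3 j aj rj.
    by rewrite bt subrr mulr0 mul0r.
  by rewrite (big_rem j) //= subrr !mul0r.
- by rewrite size_root_poly.
have [||||d d0 ed] := @extremal_below g (e *: root_series b ms).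
- exact: gE.
- split; first exact: in_tailZ.
  by move=> j; rewrite mulr_ge0 ?root_series_ge0 // ltW.
- by have [_ rn0 _] := root_series_extremal h1 ht; rewrite scaler_eq0 negb_or rn0 gt_eqF.
- move=> j; rewrite scalrfctE /GRing.scale /=; have [aj|ja] := leqP start j.
    by rewrite rE // gq // he.
  by rewrite /root_series leqNgt ja mulr0.
by exists (d * e); [exact: mulr_gt0 | rewrite -scalerA].
Qed.

End Series.

(** With all variables in the ideal the weight is the degree, so edges leave the set only from
    degree i. *)
Lemma hbelow_Top n i : exists2 c : rat, 0 < c & Top n (hbelow n n.+1 i.+1) = c *: delta i.
Proof.
exists ((i + n.+1) * layer n.+1 n.+1 i i)%:R.
  by rewrite ltr0n muln_gt0 addnS /= layer_gt0.
apply/funext => j; rewrite scalrfctE /delta /GRing.scale /=.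
rewrite -[LHS]/(Tstep n (hbelow n n.+1 i.+1) j) Tstep_hbelow //.
case: (j =P i) => [->|/eqP ji]; first by rewrite mulr1.
rewrite mulr0 (_ : layer _ _ _ _ = 0%N) ?muln0 //.
apply/eqP; rewrite -leqn0 leqNgt -has_count; apply/hasPn => m.
by rewrite mem_mons wt_full => /eqP ->.
Qed.

(** * Comparison of the extreme rays with the listed generators *)

Lemma path_leq0 (s : seq nat) : path leq 0 s = sorted leq s.
Proof. by case: s. Qed.

Lemma partition_path la : is_partition la <-> path leq 0 (rev la).
Proof. by rewrite path_leq0 rev_sorted. Qed.

Lemma le_half (m : nat) (x : int) : m%:Z <= (x %/ 2)%Z <-> (m.*2)%:Z <= x.
Proof.
by rewrite lez_divRL // -muln2 PoszM.
Qed.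

Lemma ray_generators_extremal (k : fieldType) n a g : - n%:Z <= a -> ray_generators k n a g ->
  exists2 h, extremal (Tcone n a) h & ray g = ray h.
Proof.
move=> han [[[i [i1 ia [M hM hg]]]|[la [hla _ [gV gT]]]]|[mu [hmu _ [gV gT]]]].
- have -> : g = hbelow n n.+1 i := cyclic_quotient_hilbert hM hg.
  case: i i1 ia {hM hg} => // i _ ia; have ia' : i%:Z <= a by lia.
  have [h hh hT] := Top_surj han (delta_in_tail n ia').
  have [c c0 ec] := hbelow_Top n i; exists h.
    by apply/extremal_Top => //; rewrite hT; exact: delta_extremal.
  rewrite -(ray_scale h c0); congr ray; apply: (@Top_inj n a).
  - by apply: tail_hbelow; [rewrite /= leqnn | lia].
  - exact: in_tailZ.
  - by rewrite TopZ hT.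
- have gt := proj1 (VspaceP g han) gV; exists g => //.
  have := Tstep_in_tail gt; rewrite -[Tstep n g]/(Top n g) gT even_seriesE => st.
  apply/extremal_Top => //; rewrite gT even_seriesE.
  by apply: root_series_extremal => //; apply: spaced_pair_starts; exact/partition_path.
have gt := proj1 (VspaceP g han) gV; exists g => //.
have := Tstep_in_tail gt; rewrite -[Tstep n g]/(Top n g) gT odd_seriesE => st.
apply/extremal_Top => //; rewrite gT odd_seriesE.
apply: root_series_extremal => //; rewrite addn1 -[X in spaced X]addn0.
by apply: spaced_pair_starts; exact/partition_path.
Qed.

Lemma extremal_ray_generators (k : fieldType) n a h : - n%:Z <= a -> extremal (Tcone n a) h ->
  exists2 g, ray_generators k n a g & ray g = ray h.
Proof.
move=> han hE; have ht : in_tail n a h by have [[/VspaceP hV _] _ _] := hE; exact: hV.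
have /extremal_classification[[i [ia [d d0 ed]]]|[b [ms [hms hs [d d0 ed]]]]] :=
  proj1 (extremal_Top han ht) hE.
  have [c c0 ec] := hbelow_Top n i; exists (hbelow n n.+1 i.+1).
    left; left; exists i.+1; split=> //; first by lia.
    by have [M [hM1 hM2]] := cyclic_quotient_exists k n i.+1; exists M.
  have cd : 0 < c / d by rewrite divr_gt0.
  rewrite -(ray_scale h cd); congr ray; apply: (@Top_inj n a).
  - by apply: tail_hbelow; [rewrite /= leqnn | lia].
  - exact: in_tailZ.
  - by rewrite TopZ ed ec scalerA divfK // gt_eqF.
have d1 : 0 < d^-1 by rewrite invr_gt0.
have hV : Vspace n a (d^-1 *: h) by apply/VspaceP => //; exact: in_tailZ.
have hT : Top n (d^-1 *: h) = root_series a b ms.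
  by rewrite TopZ ed scalerA mulVf ?scale1r // gt_eqF.
exists (d^-1 *: h); last exact: ray_scale.
(* As gap = ahat - a, the degree bound becomes the bound on the number of parts. *)
have gE := gapE a; have aE := ahatE a.
case: b hms hs hT {ed} => /=; rewrite ?addn1 ?addn0 => hms hs hT.
  right; have [|nu h1 h2] := @pair_starts_surj (start a).+1 0 ms; first by rewrite addn0.
  exists (rev nu); split; first by apply/partition_path; rewrite revK.
    by apply/le_half; rewrite size_rev -(size_pair_starts (start a).+1 nu) -h2; lia.
  by split=> //; rewrite hT odd_seriesE revK h2.
left; right; have [|nu h1 h2] := @pair_starts_surj (start a) 0 ms; first by rewrite addn0.
exists (rev nu); split; first by apply/partition_path; rewrite revK.
  by apply/le_half; rewrite size_rev -(size_pair_starts (start a) nu) -h2; lia.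
by split=> //; rewrite hT even_seriesE revK h2.
Qed.

Theorem corollary3p8 (k : fieldType) (n : nat) (a : int) (ha : - n%:Z <= a) :
  Qcone k n a = (\bigcap_j halfspace n a j) `&` limiting_halfspace n a
  /\ [set R | extreme_ray (Qcone k n a) R]
     = [set ray g | g in ray_generators k n a].
Proof.
rewrite QconeE // TconeE //; split=> //; rewrite -TconeE //; apply/seteqP; split=> R /=.
  move=> /(extreme_rayP _ ha)[h hE ->].
  by have [g hg eg] := extremal_ray_generators k ha hE; exists g.
move=> [g hg <-]; have [h hE eh] := ray_generators_extremal ha hg.
by apply/(extreme_rayP _ ha); exists h.
Qed.
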